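(* Let $n\ge 2$ be an integer and let $\lambda$ be a Young diagram with $\ell(\lambda)<n$ and $\gcd(n,|\lambda|)=1$. Let $\mathsf{C}=\langle \mathsf{c}\rangle$ be the cyclic group of order $n$ generated by $\mathsf{c}=\mathsf{s}_1\mathsf{s}_2\cdots\mathsf{s}_{n-1}$, acting on the set $\mathsf{SST}_n(\lambda)$ of semistandard tableaux of shape $\lambda$ with entries in $\{1,\dots,n\}$. Then: (1) every orbit of $\mathsf{SST}_n(\lambda)$ under the action of $\mathsf{C}$ is free (i.e. has exactly $n$ elements); (2) the triple $\bigl(\mathsf{SST}_n(\lambda),\ \mathsf{C},\ q^{-\kappa(\lambda)}s_\lambda(1,q,\ldots,q^{n-1})\bigr)$ exhibits the cyclic sieving phenomenon.
   Context: Partitions $\lambda=(\lambda_1\ge\lambda_2\ge\cdots\ge\lambda_\ell>0)$ are identified with Young diagrams (English convention); $\ell(\lambda)=\ell$ is the number of positive parts, $|\lambda|=\sum_i\lambda_i$, and $\kappa(\lambda)=\sum_{k}(k-1)\lambda_k$. $\mathsf{SST}_n(\lambda)$ is the set of fillings of $\lambda$ with entries in $\{1,\dots,n\}$, weakly increasing along rows and strictly increasing down columns. $s_\lambda(x_1,\dots,x_n)=\sum_{T\in\mathsf{SST}_n(\lambda)}x_1^{c_1(T)}\cdots x_n^{c_n(T)}$ is the Schur polynomial, where $c_k(T)$ is the number of entries $k$ in $T$. Crystal reflections: for $1\le i\le n-1$, the operator $\mathsf{s}_i$ on $\mathsf{SST}_n(\lambda)$ comes from the standard $U_q(\mathfrak{sl}_n)$-crystal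 structure: $\mathsf{s}_i(T)=\tilde f_i^{\,c_i(T)-c_{i+1}(T)}(T)$ if $c_i(T)\ge c_{i+1}(T)$ and $\mathsf{s}_i(T)=\tilde e_i^{\,c_{i+1}(T)-c_i(T)}(T)$ otherwise. Explicitly: read the entries of $T$ row by row, each row left to right, from the bottom row to the top row; regard each $i+1$ as ''('' and each $i$ as '')'' and match parentheses in the usual way; the unmatched letters form a subword $i^a(i+1)^b$; $\tilde f_i$ (resp. $\tilde e_i$) changes the rightmost unmatched $i$ into $i+1$ (resp. the leftmost unmatched $i+1$ into $i$); thus $\mathsf{s}_i$ replaces the unmatched subword $i^a(i+1)^b$ by $i^b(i+1)^a$ in the same positions. It is standard that $\mathsf{s}_1,\dots,\mathsf{s}_{n-1}$ define an action of the symmetric group $\mathfrak{S}_n$ (the Weyl group) on $\mathsf{SST}_n(\lambda)$, so $\mathsf{c}=\mathsf{s}_1\mathsf{s}_2\cdots\mathsf{s}_{n-1}$ (a composition of maps, rightmost applied first) is the action of a Coxeter element of order $n$, and the cyclic group $\mathsf{C}$ of order $n$ generated by this Coxeter element acts on $\mathsf{SST}_n(\lambda)$. Cyclic sieving phenomenon: for $d\ge1$ let $\omega_d$ be a primitive $d$-th root of unity. If $X$ is a finite set with an action of a finite cyclic group $C$ and $f(q)$ is a polynomial with nonnegative integer coefficients, then $(X,C,f(q))$ exhibits the cyclic sieving phenomenon if $\#\{x\in X: gx=x\}=f(\omega_{o(g)})$ for all $g\in C$, where $o(g)$ is the order of $g$ in $C$. *)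

(* Defs.v *)
From HB Require Import structures.
From mathcomp Require Import all_boot all_order all_fingroup all_algebra.
From mathcomp Require Import all_solvable all_field.
From mathcomp Require Import zify.

Set Implicit Arguments.
Unset Strict Implicit.
Unset Printing Implicit Defensive.

Import GRing.Theory.

Definition is_part (s : seq nat) : bool := sorted geq s && (0 \notin s).

Record intpart := IntPart { parts :> seq nat; partsP : is_part parts }.

(* kappa(lam) = sum_k (k-1) lam_k with k counted from 1 *)
Definition kappa (lam : intpart) : nat :=
  \sum_(k < size lam) k * nth 0 lam k.

(* Cells (r, c) of the Young diagram, rows and columns counted from 0, row 0 at
   the top (English convention). *)
Definition cell (lam : intpart) : finType :=
  {r : 'I_(size lam) & 'I_(nth 0 lam r)}.

Definition row_of (lam : intpart) (x : cell lam) : nat := tag x.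
Definition col_of (lam : intpart) (x : cell lam) : nat := tagged x.

Section Cells.

Variable lam : intpart.
Implicit Types x y z : cell lam.

Lemma cell_inj x y : row_of x = row_of y -> col_of x = col_of y -> x = y.
Proof.
case: x y => [r c] [r' c'] /= /val_inj /= E; case: r' / E c' => c'.
by rewrite /col_of /= => /val_inj ->.
Qed.

Lemma nth_parts i j : i <= j -> nth 0 lam j <= nth 0 lam i.
Proof.
have /andP[sl _] := partsP lam; move=> ij.
have [lj|] := ltnP j (size lam); last by move=> h; rewrite nth_default.
have li := leq_ltn_trans ij lj.
have tr : transitive geq by move=> a b c /= h1 h2; apply: leq_trans h2 h1.
by apply: (sorted_leq_nth tr _ 0 sl); rewrite ?inE //= => a /=.
Qed.

Lemma cell_ex y r c : r <= row_of y -> c <= col_of y ->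
  exists x, row_of x = r /\ col_of x = c.
Proof.
case: y => ry cy; rewrite /row_of /col_of /= => hr hc.
have lr : r < size lam by apply: leq_ltn_trans hr (ltn_ord ry).
have lc : c < nth 0 lam (Ordinal lr).
  by apply: leq_trans (nth_parts hr); apply: leq_ltn_trans hc (ltn_ord cy).
by exists (@Tagged _ (Ordinal lr) (fun r => 'I_(nth 0 lam r)) (Ordinal lc)).
Qed.

(* bottom row first, each row from left to right *)
Definition reading_le x y : bool :=
  (row_of y < row_of x) || (row_of x == row_of y) && (col_of x <= col_of y).

Definition reading : seq (cell lam) := sort reading_le (enum (cell lam)).

Definition reading_lt x y : bool :=
  (row_of y < row_of x) || (row_of x == row_of y) && (col_of x < col_of y).

Lemma mem_reading x : x \in reading.
Proof. by rewrite mem_sort mem_enum. Qed.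

Lemma reading_uniq : uniq reading.
Proof. by rewrite sort_uniq enum_uniq. Qed.

Lemma count_reading (P : pred (cell lam)) : count P reading = #|[set x | P x]|.
Proof.
rewrite (seq.permP (permEl (perm_sort _ _))) cardsE cardE -size_filter.
by rewrite /enum_mem -filter_predI; congr (size _); apply: eq_filter => x /=; rewrite andbT.
Qed.

Lemma reading_pairwise : pairwise reading_lt reading.
Proof.
have tr : transitive reading_lt by move=> y x z; rewrite /reading_lt; lia.
have tre : transitive reading_le by move=> y x z; rewrite /reading_le; lia.
have: pairwise reading_le reading.
  by rewrite -(sorted_pairwise tre) sort_sorted // => x y; rewrite /reading_le; lia.
have := reading_uniq; rewrite uniq_pairwise => U P.
have: pairwise [rel x y | (x != y) && reading_le x y] reading.
  by rewrite pairwise_relI U P.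
apply: sub_pairwise => x y /= /andP[/eqP ne]; rewrite /reading_le /reading_lt.
case/orP=> [->//|/andP[/eqP er ec]].
have : col_of x <> col_of y by move=> e; apply: ne; apply: cell_inj.
lia.
Qed.

Lemma reading_split l x r : reading = l ++ x :: r ->
  (forall z, (z \in l) = reading_lt z x) /\ (forall z, (z \in r) = reading_lt x z).
Proof.
move=> E; have := reading_pairwise; rewrite E pairwise_cat /= => /and3P[/allrelP h1 _].
case/andP=> /allP h2 _.
have H z : [|| z \in l, z == x | z \in r].
  by rewrite -in_cons -mem_cat -E mem_reading.
have A z : z \in l -> reading_lt z x by move=> zl; apply: h1; rewrite ?mem_head.
split=> z; apply/idP/idP.
- exact: A.
- move=> zx; case/or3P: (H z) => [//|/eqP e|/h2 xz]; move: zx.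
    by rewrite e /reading_lt; lia.
  by move: xz; rewrite /reading_lt; lia.
- exact: h2.
- move=> zx; case/or3P: (H z) => [/A xz|/eqP e|//]; move: zx.
    by move: xz; rewrite /reading_lt; lia.
  by rewrite e /reading_lt; lia.
Qed.

End Cells.

Section Parentheses.

Variable X : eqType.
Implicit Types (opn cls : pred X) (w l r : seq X).

(* Left-to-right bracket matching with a stack. A state (u, o) holds the closing
   brackets found unmatched so far and the opening brackets still pending, both
   with the rightmost one first. *)
Definition paren_step opn cls (st : seq X * seq X) (x : X) : seq X * seq X :=
  if opn x then (st.1, x :: st.2)
  else if cls x then
    if st.2 is _ :: o then (st.1, o) else (x :: st.1, [::])
  else st.

Definition unmatched opn cls w : seq X * seq X :=
  foldl (paren_step opn cls) ([::], [::]) w.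

Lemma eq_foldl_paren opn cls opn' cls' st w :
  {in w, opn =1 opn'} -> {in w, cls =1 cls'} ->
  foldl (paren_step opn cls) st w = foldl (paren_step opn' cls') st w.
Proof.
elim: w st => //= x w IH st ho hc.
have -> : paren_step opn cls st x = paren_step opn' cls' st x.
  by rewrite /paren_step ho ?mem_head // hc ?mem_head.
apply: IH => y yw.
  by apply: ho; rewrite in_cons yw orbT.
by apply: hc; rewrite in_cons yw orbT.
Qed.

Lemma paren_size_cls opn cls st w :
  size st.1 <= size (foldl (paren_step opn cls) st w).1.
Proof.
elim: w st => //= x w IH st; apply: leq_trans (IH _).
by rewrite /paren_step; case: (opn x) => //; case: (cls x) => //; case: st.2.
Qed.

Lemma paren_count opn cls (dis : forall x, opn x -> ~~ cls x) st w :
  let st' := foldl (paren_step opn cls) st w in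
  size st.2 + count opn w + size st'.1 = size st'.2 + count cls w + size st.1.
Proof.
elim: w st => [|x w IH] st /=; first by lia.
have := IH (paren_step opn cls st x); set st' := foldl _ _ _ => /=.
rewrite /paren_step; have := dis x; case: (opn x) => /= [/(_ isT)/negbTE->|_]; first by lia.
by case: (cls x) => /=; [case: st.2 => /= [|_ o] | ]; lia.
Qed.

Lemma paren_frame opn cls c c' o o' o1 w :
  foldl (paren_step opn cls) (c, o) w = (c, o1) ->
  foldl (paren_step opn cls) (c', o ++ o') w = (c', o1 ++ o').
Proof.
elim: w o => [|x w IH] o /=; first by case=> ->.
rewrite /paren_step /=; case: (opn x); first exact: (IH (x :: o)).
case: (cls x) => //; last exact: IH.
case: o => [|y o] /=; last exact: IH.
by move=> E; have := paren_size_cls opn cls (x :: c, [::]) w; rewrite E /= ltnn.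
Qed.

Lemma unmatched_clsP opn cls w x c o : unmatched opn cls w = (x :: c, o) ->
  exists l r, [/\ w = l ++ x :: r, ~~ opn x && cls x, unmatched opn cls l = (c, [::])
    & forall c' o', foldl (paren_step opn cls) (c', o') r = (c', o ++ o')].
Proof.
rewrite /unmatched; elim/last_ind: w x c o => [//|w y IH] x c o.
rewrite foldl_rcons {1}/paren_step; case E: (foldl _ _ w) => [c0 o0] /=.
case: ifP => oy.
  case=> Ec <-; move: E; rewrite Ec => /IH[l [r [-> h1 h2 h3]]].
  exists l, (rcons r y); split=> //; first by rewrite rcons_cat.
  by move=> c' o'; rewrite foldl_rcons h3 /paren_step oy.
case: ifP => cy.
  case: o0 E => [|z o0] E.
    case=> <- <- <-; exists w, [::]; split=> //; first by rewrite cats1.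
    by rewrite oy cy.
  case=> Ec <-; move: E; rewrite Ec => /IH[l [r [-> h1 h2 h3]]].
  exists l, (rcons r y); split=> //; first by rewrite rcons_cat.
  by move=> c' o'; rewrite foldl_rcons h3 /paren_step oy cy.
case=> Ec <-; move: E; rewrite Ec => /IH[l [r [-> h1 h2 h3]]].
exists l, (rcons r y); split=> //; first by rewrite rcons_cat.
by move=> c' o'; rewrite foldl_rcons h3 /paren_step oy cy.
Qed.

Lemma unmatched_opnP opn cls w x c o : unmatched opn cls w = (c, rcons o x) ->
  exists l r, [/\ w = l ++ x :: r, opn x, unmatched opn cls l = (c, [::])
    & forall c' o', foldl (paren_step opn cls) (c', o') r = (c', o ++ o')].
Proof.
rewrite /unmatched; elim/last_ind: w x c o => [x c []//|w y IH] x c o.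
rewrite foldl_rcons {1}/paren_step; case E: (foldl _ _ w) => [c0 o0] /=.
case: ifP => oy.
  case=> Ec; case/lastP: o0 E => [|o0 z] E.
    case: o => [[<-]|? []//]; exists w, [::]; split=> //; first by rewrite cats1.
    by rewrite E Ec.
  rewrite -rcons_cons => /rcons_inj[<- Ez]; move: E; rewrite Ec Ez => /IH[l [r [-> h1 h2 h3]]].
  exists l, (rcons r y); split=> //; first by rewrite rcons_cat.
  by move=> c' o'; rewrite foldl_rcons h3 /paren_step oy.
case: ifP => cy.
  case: o0 E => [|z o0] E; first by case: o => [|? ?] [].
  case=> Ec Eo; move: E; rewrite Ec Eo -rcons_cons => /IH[l [r [-> h1 h2 h3]]].
  exists l, (rcons r y); split=> //; first by rewrite rcons_cat.
  by move=> c' o'; rewrite foldl_rcons h3 /paren_step oy cy.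
case=> Ec Eo; move: E; rewrite Ec Eo => /IH[l [r [-> h1 h2 h3]]].
exists l, (rcons r y); split=> //; first by rewrite rcons_cat.
by move=> c' o'; rewrite foldl_rcons h3 /paren_step oy cy.
Qed.

End Parentheses.

Section Tableaux.

Variables (n : nat) (lam : intpart).

(* Throughout, the ordinal k : 'I_n stands for the letter k + 1, and the index
   i : 'I_n.-1 for the crystal index i + 1. *)
Definition semistandard (T : {ffun cell lam -> 'I_n}) : bool :=
  [forall x, forall y,
    ((row_of x == row_of y) && (col_of x <= col_of y) ==> (T x <= T y)) &&
    ((col_of x == col_of y) && (row_of x < row_of y) ==> (T x < T y))].

Record sst := SST { filling :> {ffun cell lam -> 'I_n}; _ : semistandard filling }.
HB.instance Definition _ := [isSub for filling].
HB.instance Definition _ := [Finite of sst by <:].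

Definition content (T : {ffun cell lam -> 'I_n}) (k : 'I_n) : nat :=
  #|[set x | T x == k]|.

Fact letter_hi_subproof (i : 'I_n.-1) : i.+1 < n.
Proof. by case: i => i /=; lia. Qed.

Definition letter_lo (i : 'I_n.-1) : 'I_n := widen_ord (leq_pred n) i.
Definition letter_hi (i : 'I_n.-1) : 'I_n := Ordinal (letter_hi_subproof i).

Implicit Types (T : {ffun cell lam -> 'I_n}) (x y z : cell lam) (i : 'I_n.-1).

Definition unmatched_cells i T : seq (cell lam) * seq (cell lam) :=
  unmatched [pred x | T x == letter_hi i] [pred x | T x == letter_lo i]
            (reading lam).

Definition set_entry T x (k : 'I_n) : {ffun cell lam -> 'I_n} :=
  [ffun y => if y == x then k else T y].

(* The value 0 of a crystal operator is encoded by leaving T unchanged; this case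
   does not occur in crystal_s. *)
Definition filling_f i T : {ffun cell lam -> 'I_n} :=
  if (unmatched_cells i T).1 is x :: _ then set_entry T x (letter_hi i) else T.

Definition filling_e i T : {ffun cell lam -> 'I_n} :=
  if (unmatched_cells i T).2 is y :: o
  then set_entry T (last y o) (letter_lo i) else T.

Lemma semistandardP T : reflect
  ((forall x y, row_of x = row_of y -> col_of x <= col_of y -> T x <= T y) /\
   (forall x y, col_of x = col_of y -> row_of x < row_of y -> T x < T y))
  (semistandard T).
Proof.
apply: (iffP forallP) => [H|[H1 H2] x].
  by split=> x y e l; have /forallP/(_ y)/andP[/implyP h1 /implyP h2] := H x;
     [apply: h1 | apply: h2]; rewrite e eqxx.
by apply/forallP => y; apply/andP; split; apply/implyP => /andP[/eqP e l];
   [apply: H1 | apply: H2].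
Qed.

Lemma letter_dis i k : (k == letter_hi i) -> ~~ (k == letter_lo i).
Proof. by move/eqP->; rewrite -val_eqE /=; lia. Qed.

Lemma letter_loP i (k : 'I_n) : (k == letter_lo i) = (k == i :> nat).
Proof. by rewrite -val_eqE. Qed.

Lemma letter_hiP i (k : 'I_n) : (k == letter_hi i) = (k == i.+1 :> nat).
Proof. by rewrite -val_eqE. Qed.

Lemma set_entry_self T x k : set_entry T x k x = k.
Proof. by rewrite ffunE eqxx. Qed.

Lemma set_entry_ne T x k y : y != x -> set_entry T x k y = T y.
Proof. by rewrite ffunE => /negbTE->. Qed.

Lemma set_entryK T x k k' : T x = k' -> set_entry (set_entry T x k) x k' = T.
Proof. by move=> e; apply/ffunP => y; rewrite !ffunE; case: eqP => // ->. Qed.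

Let opn i T := [pred x | T x == letter_hi i].
Let cls i T := [pred x | T x == letter_lo i].

Lemma unmatched_set i T x k l r : reading lam = l ++ x :: r ->
  unmatched_cells i (set_entry T x k) =
  foldl (paren_step (opn i T) (cls i T))
    (paren_step (opn i (set_entry T x k)) (cls i (set_entry T x k))
       (unmatched (opn i T) (cls i T) l) x) r.
Proof.
move=> E; rewrite /unmatched_cells /unmatched E foldl_cat /=.
have := reading_uniq lam; rewrite E cat_uniq /= => /and3P[_ /norP[xl _] /andP[xr _]].
have ne z (s : seq (cell lam)) : x \notin s -> z \in s -> z != x.
  by move=> xs zs; apply: contraNneq xs => <-.
have al : {in l, opn i (set_entry T x k) =1 opn i T} /\ {in l, cls i (set_entry T x k) =1 cls i T}.
  by split=> z zl /=; rewrite set_entry_ne ?(ne z l).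
have ar : {in r, opn i (set_entry T x k) =1 opn i T} /\ {in r, cls i (set_entry T x k) =1 cls i T}.
  by split=> z zl /=; rewrite set_entry_ne ?(ne z r).
rewrite (eq_foldl_paren _ al.1 al.2) (eq_foldl_paren _ ar.1 ar.2) //.
Qed.

Lemma unmatched_f i T x c o : unmatched_cells i T = (x :: c, o) ->
  [/\ T x = letter_lo i, filling_f i T = set_entry T x (letter_hi i)
    & unmatched_cells i (filling_f i T) = (c, rcons o x)].
Proof.
move=> E; have Ef : filling_f i T = set_entry T x (letter_hi i) by rewrite /filling_f E.
have /unmatched_clsP[l [r [Er /andP[_ /eqP Tx] El Hr]]] := E.
split=> //; rewrite Ef (unmatched_set _ _ _ Er) El {2}/paren_step /=.
by rewrite set_entry_self eqxx Hr cats1.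
Qed.

Lemma unmatched_e i T x c o : unmatched_cells i T = (c, rcons o x) ->
  [/\ T x = letter_hi i, filling_e i T = set_entry T x (letter_lo i)
    & unmatched_cells i (filling_e i T) = (x :: c, o)].
Proof.
move=> E; have Ee : filling_e i T = set_entry T x (letter_lo i).
  by rewrite /filling_e E /=; case: (o) => [|z o1] //=; rewrite last_rcons.
have /unmatched_opnP[l [r [Er /eqP Tx El Hr]]] := E.
split=> //; rewrite Ee (unmatched_set _ _ _ Er) El {2}/paren_step /=.
rewrite set_entry_self eqxx (_ : (letter_lo i == letter_hi i) = false).
  by rewrite Hr cats0.
by rewrite letter_hiP /=; lia.
Qed.

Lemma filling_fK i T : (unmatched_cells i T).1 != [::] -> filling_e i (filling_f i T) = T.
Proof.
case E: (unmatched_cells i T) => [[|x c] o] // _.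
have [Tx Ef /unmatched_e[_ -> _]] := unmatched_f E.
by rewrite Ef set_entryK.
Qed.

Lemma filling_eK i T : (unmatched_cells i T).2 != [::] -> filling_f i (filling_e i T) = T.
Proof.
case E: (unmatched_cells i T) => [c o]; case/lastP: o E => // o x E _.
have [Tx Ef /unmatched_f[_ -> _]] := unmatched_e E.
by rewrite Ef set_entryK.
Qed.

Lemma unmatched_content i T :
  content T (letter_hi i) + size (unmatched_cells i T).1 =
  content T (letter_lo i) + size (unmatched_cells i T).2.
Proof.
have := @paren_count _ (opn i T) (cls i T) (fun x => @letter_dis i (T x)) ([::], [::]) (reading lam).
rewrite -[foldl _ _ _]/(unmatched_cells i T) !count_reading /=.
by rewrite -!/(content _ _); lia.
Qed.

Lemma filling_f_semistandard i T : semistandard T -> semistandard (filling_f i T).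
Proof.
move=> sT; have /semistandardP[R C] := sT.
case E: (unmatched_cells i T) => [[|x c] o]; first by rewrite /filling_f E.
have [Tx -> _] := unmatched_f E.
have /unmatched_clsP[l [r [Er _ El Hr]]] := E.
have [ml mr] := reading_split Er.
have {}Tx : T x = i :> nat by rewrite Tx.
have right y : row_of x = row_of y -> col_of x < col_of y -> i < T y.
  move=> ry cy; have := R _ _ ry (ltnW cy); rewrite Tx leq_eqVlt => /orP[/eqP ey|//].
  have yr : y \in r by rewrite mr /reading_lt ry eqxx cy orbT.
  case: r Er Hr mr yr => // z r Er Hr mr yr.
  have xz : reading_lt x z by rewrite -mr mem_head.
  have zy : z = y \/ reading_lt z y.
    move: yr; rewrite in_cons => /orP[/eqP->|yr]; [by left|right].
    have Er' : reading lam = rcons l x ++ z :: r by rewrite cat_rcons.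
    by have [_ <-] := reading_split Er'.
  have rz : row_of z = row_of x by case: zy xz => [->//|]; rewrite /reading_lt; lia.
  have cz : col_of x <= col_of z by move: xz; rewrite /reading_lt; lia.
  have cz' : col_of z <= col_of y by case: zy xz => [->//|]; rewrite /reading_lt; lia.
  have Tz : T z = i :> nat.
    by apply/eqP; rewrite eqn_leq {1}ey R ?rz // -Tx R.
  have := Hr [::] [::]; rewrite /= {2}/paren_step /= letter_hiP letter_loP Tz eqxx.
  rewrite (_ : (i == i.+1 :> nat) = false); last by lia.
  by move=> F; have := paren_size_cls (opn i T) (cls i T) ([:: z], [::]) r; rewrite F.
have down y : col_of x = col_of y -> row_of x < row_of y -> i.+1 < T y.
  move=> cy ry; have := C _ _ cy ry; rewrite Tx leq_eqVlt => /orP[/eqP Ty|//].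
  have ry1 : row_of y = (row_of x).+1.
    apply/eqP; rewrite eqn_leq ry andbT leqNgt; apply/negP => lt.
    have [z [rz cz]] := @cell_ex _ y (row_of x).+1 (col_of x) (ltnW lt) (eq_leq cy).
    have := C x z (esym cz); rewrite rz => /(_ (ltnSn _)).
    have := C z y; rewrite rz cz => /(_ cy lt); lia.
  have exc : exists d, [exists z, [&& row_of z == row_of x, col_of z == d & T z == i :> nat]].
    by exists (col_of x); apply/existsP; exists x; rewrite !eqxx Tx /=.
  case: (ex_minnP exc) => d /existsP[z0 /and3P[/eqP rz0 /eqP cz0 /eqP Tz0]] dmin.
  have dx : d <= col_of x.
    by apply: dmin; apply/existsP; exists x; rewrite !eqxx Tx /=.
  have below z : row_of z = row_of x -> T z = i :> nat -> col_of z <= col_of x ->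
      exists u, [/\ row_of u = row_of y, col_of u = col_of z & T u = i.+1 :> nat].
    move=> rz Tz cz.
    have [u [ru cu]] := @cell_ex _ y (row_of y) (col_of z) (leqnn _) (leq_trans cz (eq_leq cy)).
    exists u; split=> //; apply/eqP; rewrite eqn_leq; apply/andP; split.
      by rewrite Ty; apply: R => //; rewrite cu -cy.
    by rewrite -Tz; apply: C; rewrite ?ru ?rz.
  have [w0 [rw0 cw0 Tw0]] : exists u, [/\ row_of u = row_of y, col_of u = col_of z0 & T u = i.+1 :> nat].
    by apply: below; rewrite ?cz0.
  have w0l : w0 \in l by rewrite ml /reading_lt rw0 ry.
  case/splitPr: w0l Er El ml => p1 p2 Er El ml.
  have mw : forall z, (z \in p1) = reading_lt z w0.
    have Er' : reading lam = p1 ++ w0 :: (p2 ++ x :: r) by rewrite Er -catA.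
    by have [] := reading_split Er'.
  have mm z : z \in w0 :: p2 -> reading_lt z x /\ ~~ reading_lt z w0.
    move=> zm; split; first by rewrite -ml mem_cat zm orbT.
    rewrite -mw; apply/negP => zp; have := reading_uniq lam.
    by rewrite Er cat_uniq => /and3P[]; rewrite cat_uniq => /and3P[_ /hasPn/(_ z zm)/negP].
  have mm' z : reading_lt z x -> ~~ reading_lt z w0 -> z \in w0 :: p2.
    by rewrite -ml -mw mem_cat => /orP[->//|].
  pose bel z := odflt z [pick u | (row_of u == row_of y) && (col_of u == col_of z)].
  have belP z : row_of z = row_of x -> T z = i :> nat -> col_of z <= col_of x ->
      [/\ row_of (bel z) = row_of y, col_of (bel z) = col_of z & T (bel z) = i.+1 :> nat].
    move=> rz Tz cz; have [u [ru cu Tu]] := below z rz Tz cz.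
    rewrite /bel; case: pickP => [u' /andP[/eqP ru' /eqP cu']|/(_ u)]; last by rewrite ru cu !eqxx.
    by rewrite /= (@cell_inj _ u' u) ?ru ?cu.
  pose S := x :: filter (cls i T) (w0 :: p2).
  have SP z : z \in S -> [/\ row_of z = row_of x, T z = i :> nat, col_of z <= col_of x & d <= col_of z].
    rewrite in_cons => /orP[/eqP->//|]; rewrite mem_filter /= letter_loP => /andP[/eqP Tz /mm[h1 h2]].
    have rz : row_of z = row_of x.
      have : row_of z = row_of x \/ (row_of z = row_of y /\ col_of w0 <= col_of z).
        by move: h1 h2; rewrite /reading_lt rw0; lia.
      by case=> [//|[rz cz]]; have := R w0 z; rewrite rw0 rz => /(_ erefl cz); rewrite Tw0 Tz ltnn.
    split=> //; first by move: h1; rewrite /reading_lt; lia.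
    by apply: dmin; apply/existsP; exists z; rewrite rz Tz !eqxx /=.
  have uS : uniq (map bel S).
    rewrite map_inj_in_uniq; last first.
      move=> a b /SP[ra Ta ca _] /SP[rb Tb cb _] eab.
      have [_ ea _] := belP a ra Ta ca; have [_ eb _] := belP b rb Tb cb.
      by apply: cell_inj; rewrite ?ra // -ea -eb eab.
    rewrite /S cons_uniq mem_filter negb_and; apply/andP; split.
      by apply/orP; right; apply/negP => /mm[]; rewrite /reading_lt; lia.
    apply: filter_uniq; have := reading_uniq lam.
    by rewrite Er cat_uniq => /andP[]; rewrite cat_uniq => /and3P[].
  have sub : {subset map bel S <= filter (opn i T) (w0 :: p2)}.
    move=> _ /mapP[z zS ->]; have [rz Tz cz dz] := SP z zS.
    have [rb cb Tb] := belP z rz Tz cz.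
    rewrite mem_filter /= letter_hiP Tb eqxx /=; apply: mm'; first by rewrite /reading_lt rb ry.
    by rewrite /reading_lt rb cb rw0 cw0 cz0; lia.
  have := uniq_leq_size uS sub; rewrite size_map size_filter.
  have -> : size S = (count (cls i T) (w0 :: p2)).+1 by rewrite -size_filter.
  move: El; rewrite /unmatched foldl_cat; set st := foldl _ _ p1 => Em.
  have := paren_size_cls (opn i T) (cls i T) st (w0 :: p2).
  have := @paren_count _ (opn i T) (cls i T) (fun x => @letter_dis i (T x)) st (w0 :: p2).
  by rewrite Em; move: (count (opn i T) _) (count (cls i T) _) => a b; rewrite /=; lia.
apply/semistandardP; split=> a b.
  move=> e ab; rewrite !ffunE; case: eqP => [ea|na]; case: eqP => [eb|nb] //=.
  - subst a; apply: right => //.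
    rewrite ltn_neqAle ab andbT; apply/eqP => ec; apply: nb.
    by apply: cell_inj.
  - by subst b; apply: leqW; rewrite -Tx; apply: R.
  - exact: R.
move=> e ab; rewrite !ffunE; case: eqP => [ea|_]; case: eqP => [eb|_] //=.
- by move: ab; rewrite ea eb ltnn.
- by subst a; apply: down.
- by subst b; apply: leqW; rewrite -Tx; apply: C.
- exact: C.
Qed.

Lemma filling_e_semistandard i T : semistandard T -> semistandard (filling_e i T).
Proof.
move=> sT; have /semistandardP[R C] := sT.
case E: (unmatched_cells i T) => [c o]; case/lastP: o E => [|o x] E; first by rewrite /filling_e E.
have [Tx -> _] := unmatched_e E.
have /unmatched_opnP[l [r [Er _ El Hr]]] := E.
have [ml mr] := reading_split Er.
have {}Tx : T x = i.+1 :> nat by rewrite Tx.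
have left y : row_of y = row_of x -> col_of y < col_of x -> T y <= i.
  move=> ry cy; have := R _ _ ry (ltnW cy); rewrite Tx leq_eqVlt ltnS => /orP[/eqP ey|//].
  have yl : y \in l by rewrite ml /reading_lt ry eqxx cy orbT.
  case/lastP: l Er El ml yl => // l z Er El ml yl.
  have zx : reading_lt z x by rewrite -ml mem_rcons mem_head.
  have yz : y = z \/ reading_lt y z.
    move: yl; rewrite mem_rcons in_cons => /orP[/eqP->|yl]; [by left|right].
    have Er' : reading lam = l ++ z :: x :: r by rewrite Er cat_rcons.
    by have [<- _] := reading_split Er'.
  have rz : row_of z = row_of x by case: yz zx => [<-//|]; rewrite /reading_lt; lia.
  have cz : col_of z <= col_of x by move: zx; rewrite /reading_lt; lia.
  have cz' : col_of y <= col_of z by case: yz zx => [->//|]; rewrite /reading_lt; lia.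
  have Tz : T z = i.+1 :> nat.
    by apply/eqP; rewrite eqn_leq -{1}Tx R ?rz //= -ey R ?rz.
  by move: El; rewrite /unmatched foldl_rcons /paren_step /= letter_hiP Tz eqxx.
have up y : col_of y = col_of x -> row_of y < row_of x -> T y < i.
  move=> cy ry; have := C _ _ cy ry; rewrite Tx ltnS leq_eqVlt => /orP[/eqP Ty|//].
  have ry1 : row_of x = (row_of y).+1.
    apply/eqP; rewrite eqn_leq ry andbT leqNgt; apply/negP => lt.
    have [z [rz cz]] := @cell_ex _ x (row_of y).+1 (col_of x) (ltnW lt) (leqnn _).
    have := C y z; rewrite rz cz => /(_ cy (ltnSn _)).
    have := C z x; rewrite rz cz => /(_ erefl lt); lia.
  pose P d := [exists z, [&& row_of z == row_of x, col_of z == d & T z == i.+1 :> nat]].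
  have exc : exists d, P d.
    by exists (col_of x); apply/existsP; exists x; rewrite !eqxx Tx /=.
  have bnd d : P d -> d <= nth 0 lam (row_of x).
    by move=> /existsP[z /and3P[/eqP<- /eqP<- _]]; apply: ltnW (ltn_ord (tagged z)).
  case: (ex_maxnP exc bnd) => d /existsP[z0 /and3P[/eqP rz0 /eqP cz0 /eqP Tz0]] dmax.
  have dx : col_of x <= d.
    by apply: dmax; apply/existsP; exists x; rewrite !eqxx Tx /=.
  have above z : row_of z = row_of x -> T z = i.+1 :> nat -> col_of x <= col_of z ->
      exists u, [/\ row_of u = row_of y, col_of u = col_of z & T u = i :> nat].
    move=> rz Tz cz.
    have [u [ru cu]] := @cell_ex _ z (row_of y) (col_of z) (leq_trans (ltnW ry) (eq_leq (esym rz))) (leqnn _).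
    exists u; split=> //; apply/eqP; rewrite eqn_leq; apply/andP; split.
      by rewrite -ltnS -Tz; apply: C; rewrite ?ru ?rz.
    by rewrite -Ty; apply: R => //; rewrite cu cy.
  have [w0 [rw0 cw0 Tw0]] : exists u, [/\ row_of u = row_of y, col_of u = col_of z0 & T u = i :> nat].
    by apply: above; rewrite ?cz0.
  have w0r : w0 \in r by rewrite mr /reading_lt rw0 ry.
  case/splitPr: w0r Er Hr mr => p1 p2 Er Hr mr.
  have mw : forall z, (z \in p2) = reading_lt w0 z.
    have Er' : reading lam = (l ++ x :: p1) ++ w0 :: p2 by rewrite Er -catA.
    by have [] := reading_split Er'.
  have mp z : z \in rcons p1 w0 -> reading_lt x z /\ ~~ reading_lt w0 z.
    move=> zm; split; first by rewrite -mr -cat_rcons mem_cat zm.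
    rewrite -mw; apply/negP => zp; have := reading_uniq lam.
    rewrite Er cat_uniq => /and3P[_ _ /=/andP[_]]; rewrite -cat_rcons cat_uniq.
    by case/and3P=> _ /hasPn/(_ z zp)/negP.
  have mp' z : reading_lt x z -> ~~ reading_lt w0 z -> z \in rcons p1 w0.
    by rewrite -mr -mw -cat_rcons mem_cat => /orP[//|->].
  pose abv z := odflt z [pick u | (row_of u == row_of y) && (col_of u == col_of z)].
  have abvP z : row_of z = row_of x -> T z = i.+1 :> nat -> col_of x <= col_of z ->
      [/\ row_of (abv z) = row_of y, col_of (abv z) = col_of z & T (abv z) = i :> nat].
    move=> rz Tz cz; have [u [ru cu Tu]] := above z rz Tz cz.
    rewrite /abv; case: pickP => [u' /andP[/eqP ru' /eqP cu']|/(_ u)]; last by rewrite ru cu !eqxx.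
    by rewrite /= (@cell_inj _ u' u) ?ru ?cu.
  pose S := x :: filter (opn i T) (rcons p1 w0).
  have SP z : z \in S -> [/\ row_of z = row_of x, T z = i.+1 :> nat, col_of x <= col_of z & col_of z <= d].
    rewrite in_cons => /orP[/eqP->//|]; rewrite mem_filter /= letter_hiP => /andP[/eqP Tz /mp[h1 h2]].
    have rz : row_of z = row_of x.
      have : row_of z = row_of x \/ (row_of z = row_of y /\ col_of z <= col_of w0).
        by move: h1 h2; rewrite /reading_lt rw0; lia.
      by case=> [//|[rz cz]]; have := R z w0; rewrite rw0 rz => /(_ erefl cz); rewrite Tw0 Tz ltnn.
    split=> //; first by move: h1; rewrite /reading_lt; lia.
    by apply: dmax; apply/existsP; exists z; rewrite rz Tz !eqxx /=.
  have uS : uniq (map abv S).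
    rewrite map_inj_in_uniq; last first.
      move=> a b /SP[ra Ta ca _] /SP[rb Tb cb _] eab.
      have [_ ea _] := abvP a ra Ta ca; have [_ eb _] := abvP b rb Tb cb.
      by apply: cell_inj; rewrite ?ra // -ea -eb eab.
    rewrite /S cons_uniq mem_filter negb_and; apply/andP; split.
      by apply/orP; right; apply/negP => /mp[]; rewrite /reading_lt; lia.
    apply: filter_uniq; have := reading_uniq lam.
    rewrite Er cat_uniq => /and3P[_ _ /=/andP[_]]; rewrite -cat_rcons cat_uniq.
    by case/and3P.
  have sub : {subset map abv S <= filter (cls i T) (rcons p1 w0)}.
    move=> _ /mapP[z zS ->]; have [rz Tz cz dz] := SP z zS.
    have [rb cb Tb] := abvP z rz Tz cz.
    rewrite mem_filter /= letter_loP Tb eqxx /=; apply: mp'; first by rewrite /reading_lt rb ry.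
    by rewrite /reading_lt rb cb rw0 cw0 cz0; lia.
  have := uniq_leq_size uS sub; rewrite size_map /S [size (x :: _)]/= !size_filter.
  have := Hr [::] [::]; rewrite -cat_rcons foldl_cat; set st := foldl _ _ (rcons p1 w0) => Em.
  have := paren_size_cls (opn i T) (cls i T) st p2.
  have := @paren_count _ (opn i T) (cls i T) (fun x => @letter_dis i (T x)) ([::], [::]) (rcons p1 w0).
  by rewrite Em -/st /=; lia.
apply/semistandardP; split=> a b.
  move=> e ab; rewrite !ffunE; case: eqP => [ea|na]; case: eqP => [eb|nb] //=.
  - by subst a; apply: ltnW; rewrite -Tx; apply: R.
  - subst b; apply: left => //.
    rewrite ltn_neqAle ab andbT; apply/eqP => ec; apply: na.
    by apply: cell_inj.
  - exact: R.
move=> e ab; rewrite !ffunE; case: eqP => [ea|_]; case: eqP => [eb|_] //=.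
- by move: ab; rewrite ea eb ltnn.
- by subst a; apply: ltnW; rewrite -Tx; apply: C.
- by subst b; apply: up.
- exact: C.
Qed.

Definition crystal_f i (T : sst) : sst :=
  SST (filling_f_semistandard i (valP T)).

Definition crystal_e i (T : sst) : sst :=
  SST (filling_e_semistandard i (valP T)).

Definition crystal_s i (T : sst) : sst :=
  let a := content T (letter_lo i) in
  let b := content T (letter_hi i) in
  if b <= a then iter (a - b) (crystal_f i) T else iter (b - a) (crystal_e i) T.

Lemma iter_crystal_f i k (T : sst) : k <= size (unmatched_cells i T).1 ->
  let T' := iter k (crystal_f i) T in
  [/\ size (unmatched_cells i T').1 = size (unmatched_cells i T).1 - k,
      size (unmatched_cells i T').2 = size (unmatched_cells i T).2 + k
    & iter k (crystal_e i) T' = T].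
Proof.
elim: k => [|k IH] lk; first by rewrite /= subn0 addn0.
have /IH := ltnW lk; cbv zeta; rewrite [iter _.+1 (crystal_f i) T]iterS [iter _.+1 (crystal_e i) _]iterSr; set T' := iter k _ T => -[h1 h2 h3].
have : size (unmatched_cells i T').1 > 0 by rewrite h1; lia.
case E: (unmatched_cells i T') h1 h2 => [[|x c] o] //= h1 h2 _.
have [_ _ Ef] := unmatched_f E.
rewrite Ef /= size_rcons; split; [lia|lia|].
rewrite -[RHS]h3; congr (iter _ _ _); apply: val_inj => /=.
by rewrite filling_fK // E.
Qed.

Lemma iter_crystal_e i k (T : sst) : k <= size (unmatched_cells i T).2 ->
  let T' := iter k (crystal_e i) T in
  [/\ size (unmatched_cells i T').1 = size (unmatched_cells i T).1 + k,
      size (unmatched_cells i T').2 = size (unmatched_cells i T).2 - k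
    & iter k (crystal_f i) T' = T].
Proof.
elim: k => [|k IH] lk; first by rewrite /= subn0 addn0.
have /IH := ltnW lk; cbv zeta; rewrite [iter _.+1 (crystal_e i) T]iterS [iter _.+1 (crystal_f i) _]iterSr; set T' := iter k _ T => -[h1 h2 h3].
have : size (unmatched_cells i T').2 > 0 by rewrite h2; lia.
case E: (unmatched_cells i T') h1 h2 => [c o]; case/lastP: o E => //= o x E.
rewrite size_rcons => h1 h2 _.
have [_ _ Ee] := unmatched_e E.
rewrite Ee /=; split; [lia|lia|].
rewrite -[RHS]h3; congr (iter _ _ _); apply: val_inj => /=.
by rewrite filling_eK // E; case: (o).
Qed.

Lemma crystal_sK i : involutive (crystal_s i).
Proof.
move=> T; rewrite {2}/crystal_s.
have := unmatched_content i T; case: leqP => [ba|ab] uc.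
  set k := _ - _; set T' := iter _ _ T.
  have /iter_crystal_f[] : k <= size (unmatched_cells i T).1 by rewrite /k; lia.
  rewrite -/T' => h1 h2 h3.
  have := unmatched_content i T'; rewrite h1 h2 /crystal_s => uc'.
  case: leqP => h; last by rewrite -[RHS]h3; congr (iter _ _ _); lia.
  have k0 : k = 0 by lia.
  have -> : content T' (letter_lo i) - content T' (letter_hi i) = 0 by lia.
  by rewrite -[RHS]h3 k0.
set k := _ - _; set T' := iter _ _ T.
have /iter_crystal_e[] : k <= size (unmatched_cells i T).2 by rewrite /k; lia.
rewrite -/T' => h1 h2 h3.
have := unmatched_content i T'; rewrite h1 h2 /crystal_s => uc'.
by case: leqP => h; [rewrite -[RHS]h3; congr (iter _ _ _); lia | lia].
Qed.

(* s_1 o s_2 o ... o s_{n-1} *)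
Definition coxeter_map : sst -> sst :=
  foldr (fun i g => crystal_s i \o g) id (enum 'I_n.-1).

Lemma coxeter_map_inj : injective coxeter_map.
Proof.
rewrite /coxeter_map; elim: (enum _) => [//|i s IH] /=.
exact: inj_comp (inv_inj (crystal_sK i)) IH.
Qed.

Definition coxeter_perm : {perm sst} := perm coxeter_map_inj.

Definition coxeter_group : {group {perm sst}} := <[coxeter_perm]>%G.

Definition schur (R : comPzSemiRingType) (x : 'I_n -> R) : R :=
  (\sum_(T : sst) \prod_(k < n) x k ^+ content T k)%R.

Definition schur_principal : {poly nat} :=
  schur (fun k : 'I_n => 'X^k)%R.

(* q^(- kappa) s_lam(1, q, ..., q^(n-1)); the division is exact by
   schur_principalE. *)
Definition schur_sieving : {poly nat} := drop_poly (kappa lam) schur_principal.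

Lemma row_le_entry (T : sst) x : row_of x <= T x.
Proof.
have /semistandardP[_ C] := valP T.
move E: (row_of x) => r; elim: r x E => [//|r IH] x rx.
have [y [ry cy]] := @cell_ex _ x r (col_of x) (ltnW (eq_leq (esym rx))) (leqnn _).
by apply: leq_ltn_trans (IH y ry) _; apply: C; rewrite ?ry ?rx.
Qed.

Lemma schur_principalE : schur_principal = (schur_sieving * 'X^(kappa lam))%R.
Proof.
rewrite /schur_sieving /schur_principal /schur drop_poly_sum mulr_suml.
apply: eq_bigr => T _.
have -> : (\prod_(k < n) ('X^k : {poly nat}) ^+ content T k)%R =
    ('X^(\sum_(x : cell lam) T x))%R.
  rewrite (partition_big T predT) //= expr_sum.
  apply: eq_bigr => k _; rewrite -exprM; congr ('X^_)%R.
  rewrite (eq_bigr (fun=> k : nat)) => [|x /eqP->//].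
  by rewrite sum_nat_const mulnC /content cardsE.
have le : kappa lam <= \sum_(x : cell lam) T x.
  have -> : kappa lam = \sum_(x : cell lam) row_of x.
    rewrite /kappa; set J := fun r : 'I_(size lam) => 'I_(nth 0 lam r).
    have := @sig_big_dep _ 0 addn _ J xpredT (fun=> xpredT) (fun r _ => nat_of_ord r).
    move=> /= <-; apply: eq_bigr => r _.
    by rewrite sum_nat_const card_ord mulnC.
  by apply: leq_sum => x _; apply: row_le_entry.
by rewrite -(subnK le) exprD drop_polyMXn_id.
Qed.

End Tableaux.

Definition exhibits_csp (gT : finGroupType) (C : {group gT}) (X : finType)
    (to : {action gT &-> X}) (f : {poly nat}) : Prop :=
  cyclic C /\
  forall (g : gT) (w : algC),
    g \in C -> (#[g]%g.-primitive_root w)%R ->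
    (#|'Fix_to[g]%g|%:R = (map_poly (fun k : nat => k%:R) f).[w])%R.

(* Main.v *)
Require Import Defs.
From HB Require Import structures.
From mathcomp Require Import all_boot all_order all_fingroup all_algebra.
From mathcomp Require Import all_solvable all_field.
From mathcomp Require Import zify.

Set Implicit Arguments.
Unset Strict Implicit.
Unset Printing Implicit Defensive.

Import GRing.Theory.

(** Let [M T] be the sum of the entries of [T]. The map [c]
    rotates the content of [T] cyclically, so [M (c T) = M T + |lam|] modulo [n].
    As [|lam|] is prime to [n], [c^j T = T] forces [n] to divide [j], and for an
    [n]-th root of unity [w <> 1] reindexing by [c] multiplies [sum_T w^(M T)] by
    [w^|lam| <> 1], so that this sum vanishes.

    The relation [c^n = 1] follows from the Coxeter relations of the reflections
    [s_i]. Only the braid relation is hard. A tableau is replaced by its reading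
    word, and words by the crystal structure on them, which obeys the tensor
    product rule. Each elementary Knuth relation on the letters [0, 1, 2] is a
    crystal isomorphism on words of length three, hence on factors of any word;
    row insertion thus reduces the braid relation to the reading words
    [2^a 1^b 2^c 0^d 1^e 2^f] of tableaux, where both reflections are explicit
    piecewise linear maps of the exponents. *)

(** * Crystal operators on words *)

Section WordCrystal.

Variable i : nat.
Implicit Types (u v w z : seq nat).

(* ncls and nopn count the unmatched letters i = ")" and i + 1 = "(". *)
Fixpoint ncls w : nat :=
  if w is x :: v then if x == i.+1 then (ncls v).-1 else (x == i) + ncls v
  else 0.

Fixpoint nopn w : nat :=
  if w is x :: v then ((x == i.+1) && (ncls v == 0)) + nopn v else 0.

(** The head can be the rightmost unmatched [i] only if the tail has none left after the head is
    taken into account. A word with no letter to change is returned as it is, like the value 0 of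
    the operators on tableaux. *)
Fixpoint word_f w : seq nat :=
  if w is x :: v then
    if (x == i.+1) < ncls v then x :: word_f v
    else (if x == i then i.+1 else x) :: v
  else [::].

Fixpoint word_e w : seq nat :=
  if w is x :: v then
    if (x == i.+1) && (ncls v == 0) then i :: v else x :: word_e v
  else [::].

(* By [ncls_nopn_count] this is the comparison of the contents of i and i + 1. *)
Definition word_s w : seq nat :=
  if nopn w <= ncls w then iter (ncls w - nopn w) word_f w
  else iter (nopn w - ncls w) word_e w.

(** The pending openings of [u] absorb unmatched closings of [v], one for one; truncated subtraction
    records what survives on either side. *)
Lemma ncls_nopn_cat u v :
  ncls (u ++ v) = ncls u + (ncls v - nopn u) /\
  nopn (u ++ v) = (nopn u - ncls v) + nopn v.
Proof.
elim: u => [|x u [IH1 IH2]] /=; first by lia.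
by rewrite IH1 IH2; case: (x == i.+1) => /=; lia.
Qed.

Lemma ncls_cat u v : ncls (u ++ v) = ncls u + (ncls v - nopn u).
Proof. by case: (ncls_nopn_cat u v). Qed.

Lemma nopn_cat u v : nopn (u ++ v) = (nopn u - ncls v) + nopn v.
Proof. by case: (ncls_nopn_cat u v). Qed.

Lemma word_f_id w : ncls w = 0 -> word_f w = w.
Proof.
case: w => //= x w; case: eqP => /= [->|_].
  by move=> h; rewrite ltnNge (_ : ncls w <= 1) ?gtn_eqF //; lia.
by case: (x == i) => //=; rewrite add0n => ->.
Qed.

Lemma word_e_id w : nopn w = 0 -> word_e w = w.
Proof. by elim: w => //= x w IH; case: (_ && _) => //= /IH->. Qed.

(** Tensor product rule: the rightmost unmatched [i] lies in [v] exactly when the openings pending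
    in [u] do not absorb all unmatched closings of [v]. *)
Lemma word_f_cat u v :
  word_f (u ++ v) = if nopn u < ncls v then u ++ word_f v else word_f u ++ v.
Proof.
elim: u => [|x u IH] /=.
  by case: posnP => // /word_f_id.
rewrite IH ncls_cat; case: (x == i.+1) => /=; case: (ncls u =P 0) => /= hu;
case: (ltnP (nopn u) (ncls v)) => h1; case: ltnP => h2; try (by []);
try (by lia); try (by case: ltnP => h3 //; lia);
by rewrite hu /= ltnNge (_ : ncls v <= 1 + nopn u) //; lia.
Qed.

Lemma word_e_cat u v :
  word_e (u ++ v) = if ncls v < nopn u then word_e u ++ v else u ++ word_e v.
Proof.
elim: u => [|x u IH] //=; rewrite IH ncls_cat.
case: (x == i.+1) => /=; last by case: ifP.
case: (ncls u =P 0) => [->|/eqP/negbTE h] /=; last by rewrite addn_eq0 h /=; case: ifP.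
rewrite add0n subn_eq0 add1n ltnS; case: leqP => // h.
by rewrite (ltnW h).
Qed.

Lemma size_word_f w : size (word_f w) = size w.
Proof. by elim: w => //= x w IH; case: ifP => //= _; rewrite IH. Qed.

Lemma size_word_e w : size (word_e w) = size w.
Proof. by elim: w => //= x w IH; case: ifP => //= _; rewrite IH. Qed.

Lemma word_f_ncls_nopn w : 0 < ncls w ->
  ncls (word_f w) = (ncls w).-1 /\ nopn (word_f w) = (nopn w).+1.
Proof.
elim: w => //= x w IH; case hx: (x == i.+1) => /=.
  case: (ltnP 1 (ncls w)) => /=; last by lia.
  by rewrite hx => h _; have [-> ->] := IH (ltnW h); lia.
case: (posnP (ncls w)) => [e0|h] /=; last by have [-> ->] := IH h; rewrite hx; lia.
by rewrite e0; case: (x =P i) => //= _ _; rewrite [_ == _]eqxx.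
Qed.

Lemma word_e_ncls_nopn w : 0 < nopn w ->
  ncls (word_e w) = (ncls w).+1 /\ nopn (word_e w) = (nopn w).-1.
Proof.
have hi : (i == i.+1) = false by apply/eqP; lia.
elim: w => //= x w IH; case hx: (x == i.+1) => /=; last first.
  by rewrite add0n => /IH[-> ->]; rewrite hx; lia.
case: (ncls w =P 0) => /= [->|h]; first by rewrite hi eqxx; lia.
by rewrite add0n hx => /IH[-> ->] /=; lia.
Qed.

Lemma size_word_s w : size (word_s w) = size w.
Proof.
by rewrite /word_s; case: leqP => _; elim: (_ - _) => //= k;
  rewrite ?size_word_f ?size_word_e.
Qed.

Lemma ncls_nseq k x : ncls (nseq k x) = (x == i) * k.
Proof. by elim: k => [|k /= ->]; [rewrite muln0 | do 2![case: eqP]; lia]. Qed.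

Lemma nopn_nseq k x : nopn (nseq k x) = (x == i.+1) * k.
Proof.
elim: k => [|k /= ->]; [by rewrite muln0 | rewrite ncls_nseq].
by do 2![case: eqP]; lia.
Qed.

Lemma word_f_nseq p q :
  word_f (nseq p.+1 i ++ nseq q i.+1) = nseq p i ++ nseq q.+1 i.+1.
Proof.
rewrite -addn1 nseqD -catA word_f_cat nopn_nseq /= ncls_nseq.
by rewrite (gtn_eqF (ltnSn i)) ltn_eqF //= eqxx.
Qed.

Lemma word_e_nseq p q :
  word_e (nseq p i ++ nseq q.+1 i.+1) = nseq p.+1 i ++ nseq q i.+1.
Proof.
rewrite word_e_cat nopn_nseq /= ncls_nseq.
rewrite (gtn_eqF (ltnSn i)) (ltn_eqF (ltnSn i)) //= eqxx /=.
by rewrite -[RHS]/(nseq p.+1 i ++ _) -(addn1 p) nseqD -catA.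
Qed.

Lemma word_s_nseq p q :
  word_s (nseq p i ++ nseq q i.+1) = nseq q i ++ nseq p i.+1.
Proof.
rewrite /word_s ncls_cat nopn_cat !ncls_nseq !nopn_nseq.
rewrite !eqxx (gtn_eqF (ltnSn i)) (ltn_eqF (ltnSn i)) !mul1n !mul0n.
rewrite !sub0n addn0 add0n; case: leqP => h.
  have iterf k a b : iter k word_f (nseq (k + a) i ++ nseq b i.+1) =
      nseq a i ++ nseq (k + b) i.+1.
    by elim: k b => // k IH b; rewrite addSn iterSr word_f_nseq IH addnS.
  by have := iterf (p - q) q q; rewrite subnK.
have itere k a b : iter k word_e (nseq a i ++ nseq (k + b) i.+1) =
    nseq (k + a) i ++ nseq b i.+1.
  by elim: k a => // k IH a; rewrite addSn iterSr word_e_nseq IH addnS.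
by have := itere (q - p) p p; rewrite subnK // ltnW.
Qed.

Definition insert_at p z w := take p w ++ z ++ drop p w.

Lemma insert_atE p u z v : size u = p -> insert_at p z (u ++ v) = u ++ z ++ v.
Proof. by move=> <-; rewrite /insert_at take_size_cat // drop_size_cat. Qed.

Section Balanced.
Variables (p : nat) (z : seq nat).
Hypotheses (z_cls : ncls z = 0) (z_opn : nopn z = 0).

Lemma ncls_insert w : ncls (insert_at p z w) = ncls w.
Proof. by rewrite -{2}(cat_take_drop p w) !ncls_cat z_cls z_opn; lia. Qed.

Lemma nopn_insert w : nopn (insert_at p z w) = nopn w.
Proof. by rewrite -{2}(cat_take_drop p w) !nopn_cat !ncls_cat z_cls z_opn; lia. Qed.

(** A factor without unmatched letters is inert, and the operators preserve length, so its position
    never moves. Matched blocks can thus be removed before a reflection is computed and put back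
    afterwards. *)
Lemma word_f_insert w : word_f (insert_at p z w) = insert_at p z (word_f w).
Proof.
have [ge|lt] := leqP (size w) p.
  rewrite /insert_at !take_oversize ?drop_oversize ?size_word_f //.
  by rewrite cats0 word_f_cat z_cls.
rewrite -{2}(cat_take_drop p w) !word_f_cat ncls_cat z_cls z_opn subn0 add0n.
have sz : size (take p w) = p by rewrite size_takel // ltnW.
case: ifP => h.
  rewrite (insert_atE _ _ sz); congr (_ ++ _); case: ifP => // /negbT.
  by rewrite -eqn0Ngt => /eqP e; rewrite word_f_id // word_f_id.
have sz' : size (word_f (take p w)) = p by rewrite size_word_f.
by rewrite (insert_atE _ _ sz').
Qed.

Lemma word_e_insert w : word_e (insert_at p z w) = insert_at p z (word_e w).
Proof.
have [ge|lt] := leqP (size w) p.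
  rewrite /insert_at !take_oversize ?drop_oversize ?size_word_e //.
  rewrite cats0 word_e_cat z_cls; case: posnP => // /word_e_id->.
  by rewrite word_e_id.
rewrite -{2}(cat_take_drop p w) !word_e_cat ncls_cat z_cls z_opn subn0 add0n.
have sz : size (take p w) = p by rewrite size_takel // ltnW.
case: ifP => h.
  have sz' : size (word_e (take p w)) = p by rewrite size_word_e.
  by rewrite (insert_atE _ _ sz').
by rewrite (insert_atE _ _ sz).
Qed.

Lemma word_s_insert w : word_s (insert_at p z w) = insert_at p z (word_s w).
Proof.
rewrite /word_s ncls_insert nopn_insert; case: ifP => _.
  by elim: (_ - _) => //= k ->; rewrite word_f_insert.
by elim: (_ - _) => //= k ->; rewrite word_e_insert.
Qed.

End Balanced.
End WordCrystal.

(** * Knuth relations *)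

(* Only the crystal operators with index 0 and 1 are considered; letters above 2
   are neutral. *)
Record crystal_iso (m : seq nat -> seq nat) : Prop := CrystalIso {
  iso_inj : injective m;
  iso_size : forall w, size (m w) = size w;
  iso_ncls : forall i w, i < 2 -> ncls i (m w) = ncls i w;
  iso_nopn : forall i w, i < 2 -> nopn i (m w) = nopn i w;
  iso_f : forall i w, i < 2 -> m (word_f i w) = word_f i (m w);
  iso_e : forall i w, i < 2 -> m (word_e i w) = word_e i (m w)
}.

(* Requiring only injectivity, rather than bijectivity, of the isomorphism makes
   this a preorder, which is all that transporting the braid relation needs. *)
Definition plactic (w w' : seq nat) : Prop :=
  exists2 m, crystal_iso m & m w = w'.

Lemma plactic_refl w : plactic w w.
Proof. by exists id; first split. Qed.

Lemma plactic_trans v u w : plactic u v -> plactic v w -> plactic u w.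
Proof.
case=> m1 [i1 s1 c1 o1 f1 e1] <- [m2 [i2 s2 c2 o2 f2 e2] <-]; exists (m2 \o m1) => //.
split=> [|x|i x hi|i x hi|i x hi|i x hi] /=; first exact: inj_comp.
- by rewrite s2 s1.
- by rewrite c2 // c1.
- by rewrite o2 // o1.
- by rewrite f1 // f2.
- by rewrite e1 // e2.
Qed.

(** The isomorphism acts on everything after position [size l]. By the tensor product rule, the
    factor on which an operator acts depends only on [ncls] and [nopn], which [m] preserves. *)
Lemma plactic_catr l u v : plactic u v -> plactic (l ++ u) (l ++ v).
Proof.
case=> m [im sm cm om fm em] <-; set p := size l.
exists (fun w => take p w ++ m (drop p w)); last by rewrite take_size_cat ?drop_size_cat.
split.
- move=> w1 w2 e; have s12 : size w1 = size w2.
    by have := congr1 size e; rewrite !size_cat !sm -!size_cat !cat_take_drop.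
  have st : size (take p w1) = size (take p w2) by rewrite !size_take s12.
  move/eqP: e; rewrite eqseq_cat // => /andP[/eqP e1 /eqP/im e2].
  by rewrite -(cat_take_drop p w1) e1 e2 cat_take_drop.
- by move=> w; rewrite size_cat sm -size_cat cat_take_drop.
- by move=> i w hi; rewrite -{3}(cat_take_drop p w) !ncls_cat cm.
- by move=> i w hi; rewrite -{3}(cat_take_drop p w) !nopn_cat cm // om.
- move=> i w hi; have [ge|lt] := leqP (size w) p.
    rewrite !take_oversize ?drop_oversize ?size_word_f // word_f_cat cm //.
  have sz : size (take p w) = p by rewrite size_takel // ltnW.
  rewrite -{1 2}(cat_take_drop p w) !word_f_cat cm //; case: ifP => _.
    by rewrite take_size_cat // drop_size_cat // fm.
  by rewrite take_size_cat ?size_word_f // drop_size_cat ?size_word_f.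
move=> i w hi; have [ge|lt] := leqP (size w) p.
  rewrite !take_oversize ?drop_oversize ?size_word_e // word_e_cat cm //.
  have m0 : m [::] = [::] by apply: size0nil; rewrite sm.
  by rewrite m0 /= !cats0; case: posnP => // /word_e_id.
have sz : size (take p w) = p by rewrite size_takel // ltnW.
rewrite -{1 2}(cat_take_drop p w) !word_e_cat cm //; case: ifP => _.
  by rewrite take_size_cat ?size_word_e // drop_size_cat ?size_word_e.
by rewrite take_size_cat // drop_size_cat // em.
Qed.

Lemma plactic_catl r u v : plactic u v -> plactic (u ++ r) (v ++ r).
Proof.
case=> m [im sm cm om fm em] <-; set p := size u.
exists (fun w => m (take p w) ++ drop p w); last by rewrite take_size_cat ?drop_size_cat.
split.
- move=> w1 w2 e; have s12 : size w1 = size w2.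
    by have := congr1 size e; rewrite !size_cat !sm -!size_cat !cat_take_drop.
  have st : size (m (take p w1)) = size (m (take p w2)) by rewrite !sm !size_take s12.
  move/eqP: e; rewrite eqseq_cat // => /andP[/eqP/im e1 /eqP e2].
  by rewrite -(cat_take_drop p w1) e1 e2 cat_take_drop.
- by move=> w; rewrite size_cat sm -size_cat cat_take_drop.
- by move=> i w hi; rewrite -{3}(cat_take_drop p w) !ncls_cat cm // om.
- by move=> i w hi; rewrite -{3}(cat_take_drop p w) !nopn_cat om.
- move=> i w hi; have [ge|lt] := leqP (size w) p.
    by rewrite !take_oversize ?drop_oversize ?size_word_f // !cats0 fm.
  have sz : size (take p w) = p by rewrite size_takel // ltnW.
  rewrite -{1 2}(cat_take_drop p w) !word_f_cat om //; case: ifP => _.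
    by rewrite take_size_cat // drop_size_cat.
  by rewrite take_size_cat ?size_word_f // drop_size_cat ?size_word_f // fm.
move=> i w hi; have [ge|lt] := leqP (size w) p.
  by rewrite !take_oversize ?drop_oversize ?size_word_e // !cats0 em.
have sz : size (take p w) = p by rewrite size_takel // ltnW.
rewrite -{1 2}(cat_take_drop p w) !word_e_cat om //; case: ifP => _.
  by rewrite take_size_cat ?size_word_e // drop_size_cat ?size_word_e // em.
by rewrite take_size_cat // drop_size_cat.
Qed.

(* Each three-letter word lies in at most one elementary Knuth relation, so that
   these relations define an involution. *)
Definition knuth w : seq nat :=
  if w is [:: a; b; c] then
    if (2 < a) || (2 < b) || (2 < c) then w
    else if (c < a <= b) || (b < a <= c) then [:: a; c; b]
    else if (a <= c < b) || (b <= c < a) then [:: b; a; c]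
    else w
  else w.

Definition swap_neutral w : seq nat :=
  if w is [:: x; y] then if (2 < x) == (2 < y) then w else [:: y; x] else w.

Lemma knuth_id w : size w != 3 -> knuth w = w.
Proof. by case: w => [|a [|b [|c []]]]. Qed.

Lemma swap_neutral_id w : size w != 2 -> swap_neutral w = w.
Proof. by case: w => [|a [|b []]]. Qed.

(** A finite check on words of length three, each letter being 0, 1, 2 or neutral. Injectivity holds
    because the map is an involution. *)
Lemma knuth_iso : crystal_iso knuth.
Proof.
split.
- apply: (can_inj (g := knuth)); case=> [|a [|b [|c []]]] //.
  by case: a => [|[|[|a]]]; case: b => [|[|[|b]]]; case: c => [|[|[|c]]].
- by case=> [|a [|b [|c []]]] //=; case: ifP => // _; case: ifP => // _; case: ifP.
- move=> i w hi; case: w => [|a [|b [|c []]]] //; case: i hi => [|[|//]] _;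
  by case: a => [|[|[|a]]]; case: b => [|[|[|b]]]; case: c => [|[|[|c]]].
- move=> i w hi; case: w => [|a [|b [|c []]]] //; case: i hi => [|[|//]] _;
  by case: a => [|[|[|a]]]; case: b => [|[|[|b]]]; case: c => [|[|[|c]]].
- move=> i w hi; have [|ne] := eqVneq (size w) 3; last first.
    by rewrite !knuth_id ?size_word_f.
  case: w => [|a [|b [|c []]]] // _; case: i hi => [|[|//]] _;
  by case: a => [|[|[|a]]]; case: b => [|[|[|b]]]; case: c => [|[|[|c]]].
move=> i w hi; have [|ne] := eqVneq (size w) 3; last first.
  by rewrite !knuth_id ?size_word_e.
case: w => [|a [|b [|c []]]] // _; case: i hi => [|[|//]] _;
by case: a => [|[|[|a]]]; case: b => [|[|[|b]]]; case: c => [|[|[|c]]].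
Qed.

Lemma swap_neutral_iso : crystal_iso swap_neutral.
Proof.
split.
- apply: (can_inj (g := swap_neutral)); case=> [|a [|b []]] //.
  by case: a => [|[|[|a]]]; case: b => [|[|[|b]]].
- by case=> [|a [|b []]] //=; case: ifP.
- move=> i w hi; case: w => [|a [|b []]] //; case: i hi => [|[|//]] _;
  by case: a => [|[|[|a]]]; case: b => [|[|[|b]]].
- move=> i w hi; case: w => [|a [|b []]] //; case: i hi => [|[|//]] _;
  by case: a => [|[|[|a]]]; case: b => [|[|[|b]]].
- move=> i w hi; have [|ne] := eqVneq (size w) 2; last first.
    by rewrite !swap_neutral_id ?size_word_f.
  case: w => [|a [|b []]] // _; case: i hi => [|[|//]] _;
  by case: a => [|[|[|a]]]; case: b => [|[|[|b]]].
move=> i w hi; have [|ne] := eqVneq (size w) 2; last first.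
  by rewrite !swap_neutral_id ?size_word_e.
case: w => [|a [|b []]] // _; case: i hi => [|[|//]] _;
by case: a => [|[|[|a]]]; case: b => [|[|[|b]]].
Qed.

Lemma plactic_yzx x y z : x < y -> y <= z -> z < 3 ->
  plactic [:: y; z; x] [:: y; x; z].
Proof.
move=> xy yz z3; exists knuth; first exact: knuth_iso.
by rewrite /knuth ifF ?ifT //; lia.
Qed.

Lemma plactic_xzy x y z : x <= y -> y < z -> z < 3 ->
  plactic [:: x; z; y] [:: z; x; y].
Proof.
move=> xy yz z3; exists knuth; first exact: knuth_iso.
rewrite /knuth; case: ifP => [|_]; first by lia.
case: ifP => [|_]; first by lia.
by case: ifP => //; lia.
Qed.

Lemma plactic_neutral x y : 2 < x -> y < 3 -> plactic [:: x; y] [:: y; x].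
Proof.
move=> x3 y3; exists swap_neutral; first exact: swap_neutral_iso.
by rewrite /swap_neutral x3 ltnNge -ltnS y3.
Qed.

(** * Row insertion through Knuth relations *)

Lemma plactic_neutrals s y : all (ltn 2) s -> y < 3 -> plactic (rcons s y) (y :: s).
Proof.
elim: s => [|x s IH] /=; first by move=> *; apply: plactic_refl.
case/andP=> x3 s3 y3; apply: plactic_trans (plactic_catl s (plactic_neutral x3 y3)).
exact: (plactic_catr [:: x] (IH s3 y3)).
Qed.

(** One row insertion step, ejecting the first letter [y] greater than [x]: [x] travels left through
    [v] by the relations [plactic_yzx], then [y] travels left through [u] by the relations
    [plactic_xzy]. *)
Lemma plactic_bump x y u v : x < y -> sorted leq (rcons u x) -> path leq y v ->
  y < 3 -> all (gtn 3) v ->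
  plactic (u ++ y :: rcons v x) (y :: u ++ x :: v).
Proof.
move=> xy su pv y3 v3.
have right : plactic (y :: rcons v x) [:: y, x & v].
  elim/last_ind: v pv v3 => [|v z IH]; first by move=> *; apply: plactic_refl.
  rewrite rcons_path all_rcons => /andP[pv lz] /= /andP[z3 v3].
  have := plactic_catl [:: z] (IH pv v3); rewrite /= !cats1; apply: plactic_trans.
  have -> : y :: rcons (rcons v z) x = belast y v ++ [:: last y v; z; x].
    by rewrite -cat_rcons -lastI -cats1 -cats1 -catA.
  have -> : y :: rcons (rcons v x) z = belast y v ++ [:: last y v; x; z].
    by rewrite -cat_rcons -lastI -cats1 -cats1 -catA.
  apply: plactic_catr; apply: plactic_yzx => //.
  have /allP h := order_path_min leq_trans pv; apply: leq_trans xy _.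
  by have := mem_last y v; rewrite in_cons => /orP[/eqP->|/h].
apply: plactic_trans (plactic_catr u right) _.
suff left : plactic (u ++ [:: y; x]) (y :: u ++ [:: x]).
  by have := plactic_catl v left; rewrite /= -!catA.
(* The induction varies [x]: once [y] has passed the last letter [t] of the row, [t] takes over the
   role of [x]. *)
elim/last_ind: u x xy su {right} => [|u t IH] x xy; first by move=> *; apply: plactic_refl.
move=> su; have tx : t <= x.
  by move: su; rewrite /sorted; case: (u) => [|? ?] /=; rewrite ?rcons_path ?last_rcons => /andP[].
have {}su : sorted leq (rcons u t).
  by move: su; rewrite -[rcons (rcons u t) x]cats1;
    apply: subseq_sorted leq_trans _ _ (prefix_subseq _ _).
have := plactic_catl [:: x] (IH t (leq_ltn_trans tx xy) su).
rewrite !cat_rcons /= -!catA /=; apply: plactic_trans.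
by apply: plactic_catr; apply: plactic_xzy.
Qed.

(** * The braid relation *)

(* Row reading word of the tableau with rows 0^d 1^e 2^f, 1^b 2^c and 2^a. *)
Definition tab3 a b c d e f : seq nat :=
  nseq a 2 ++ nseq b 1 ++ nseq c 2 ++ nseq d 0 ++ nseq e 1 ++ nseq f 2.

(** Strictness of columns: a [2] of the bottom row lies below a [1], a [1] of the middle row below a
    [0], and a [2] of the middle row below a [0] or a [1]. *)
Definition is_tab3 a b c d e : bool := [&& a <= b, b <= d & b + c <= d + e].

Lemma nseq_rcons (T : Type) k (x : T) : rcons (nseq k x) x = nseq k.+1 x.
Proof. by elim: k => //= k ->. Qed.

Lemma sorted_blocks d e f : sorted leq (nseq d 0 ++ nseq e 1 ++ nseq f 2).
Proof.
have blk k x s : sorted leq s -> all (leq x) s -> sorted leq (nseq k x ++ s).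
  move=> ss h; elim: k => //= k IH; rewrite path_min_sorted ?IH //.
  by rewrite all_cat h andbT all_nseq /= leqnn orbT.
by apply: (blk); [apply: (blk); [have := blk f 2 [::]; rewrite cats0; apply|]|];
  rewrite ?all_cat ?all_nseq /= ?orbT.
Qed.

(** Row insertion of [x] into the top row. An ejected letter comes to stand in front of its row,
    that is, at the end of the row below, where it is inserted in turn; the cases list the ejected
    letters. *)
Lemma plactic_tab3_rcons a b c d e f x : is_tab3 a b c d e -> x < 3 ->
  exists a' b' c' d' e' f', is_tab3 a' b' c' d' e' /\
    plactic (rcons (tab3 a b c d e f) x) (tab3 a' b' c' d' e' f').
Proof.
move=> /and3P[h1 h2 h3]; rewrite /tab3 !rcons_cat; case: x => [|[|[|//]]] _.
- case: e h3 => [|e] h3.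
    case: f => [|f].
      exists a, b, c, d.+1, 0, 0; split; first by apply/and3P; split; lia.
      by rewrite -(nseq_rcons d) /= cats0 cats1; apply: plactic_refl.
    exists a, b, c.+1, d.+1, 0, f; split; first by apply/and3P; split; lia.
    rewrite -(nseq_rcons c) -(nseq_rcons d) !cat_rcons /=; do 3!apply: plactic_catr.
    by apply: plactic_bump; rewrite ?nseq_rcons ?all_nseq ?orbT //;
       [have := sorted_blocks d.+1 0 0|have := sorted_blocks 0 0 f.+1]; rewrite /= ?cats0.
  (* The top row contains a [1], which [0] ejects and which then enters the middle row. *)
  have row1 : plactic (nseq d 0 ++ nseq e.+1 1 ++ rcons (nseq f 2) 0)
      (1 :: nseq d.+1 0 ++ nseq e 1 ++ nseq f 2).
    rewrite -(nseq_rcons d) cat_rcons /= -rcons_cat.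
    apply: plactic_bump => //; rewrite ?nseq_rcons ?all_cat ?all_nseq ?orbT //.
      by have := sorted_blocks d.+1 0 0; rewrite /= cats0.
    by have := sorted_blocks 0 e.+1 f.
  case: c h3 => [|c] h3.
    exists a, b.+1, 0, d.+1, e, f; split; first by apply/and3P; split; lia.
    by rewrite -(nseq_rcons b) cat_rcons; do 2!apply: plactic_catr.
  exists a.+1, b.+1, c, d.+1, e, f; split; first by apply/and3P; split; lia.
  rewrite -(nseq_rcons a) cat_rcons; apply: plactic_catr.
  apply: plactic_trans (plactic_catr _ (plactic_catr _ row1)) _.
  (* In the middle row this [1] ejects a [2], which extends the bottom row. *)
  have bump : plactic (nseq b 1 ++ 2 :: rcons (nseq c 2) 1) (2 :: nseq b 1 ++ 1 :: nseq c 2).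
    apply: plactic_bump; rewrite ?nseq_rcons ?all_nseq ?orbT //.
      by have := sorted_blocks 0 b.+1 0; rewrite /= cats0.
    by have := sorted_blocks 0 0 c.+1.
  move: (nseq d.+1 0 ++ _) => R; rewrite -(nseq_rcons b) cat_rcons.
  by have := plactic_catl R bump; rewrite /= -!catA /= cat_rcons.
- case: f => [|f].
    exists a, b, c, d, e.+1, 0; split; first by apply/and3P; split; lia.
    by rewrite -(nseq_rcons e) /= cats0 cats1; apply: plactic_refl.
  exists a, b, c.+1, d, e.+1, f; split; first by apply/and3P; split; lia.
  rewrite -(nseq_rcons c) -(nseq_rcons e) !cat_rcons /=; do 3!apply: plactic_catr.
  rewrite !catA.
  apply: plactic_bump; rewrite ?all_nseq ?orbT // ?rcons_cat ?nseq_rcons.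
    by have := sorted_blocks d e.+1 0; rewrite cats0.
  by have := sorted_blocks 0 0 f.+1.
exists a, b, c, d, e, f.+1; split; first by apply/and3P.
by rewrite nseq_rcons; apply: plactic_refl.
Qed.

(** Letters are inserted one at a time. Neutral ones accumulate in the suffix [s]; any other letter
    first moves left across [s]. *)
Lemma plactic_tab3 w : exists a b c d e f s,
  [/\ is_tab3 a b c d e, all (ltn 2) s & plactic w (tab3 a b c d e f ++ s)].
Proof.
elim/last_ind: w => [|w x [a [b [c [d [e [f [s [ht hs hw]]]]]]]]].
  by exists 0, 0, 0, 0, 0, 0, [::]; split=> //; apply: plactic_refl.
have := plactic_catl [:: x] hw; rewrite cats1 -catA cats1 => hwx.
have [x3|x3] := ltnP x 3; last first.
  by exists a, b, c, d, e, f, (rcons s x); rewrite all_rcons hs andbT; split.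
have [a' [b' [c' [d' [e' [f' [ht' hp]]]]]]] := plactic_tab3_rcons f ht x3.
exists a', b', c', d', e', f', s; split=> //; apply: plactic_trans hwx _.
apply: plactic_trans (plactic_catr _ (plactic_neutrals hs x3)) _.
by rewrite -cat_rcons; apply: plactic_catl.
Qed.

Lemma word_s0_tab3 a b c d e f : b <= d ->
  word_s 0 (tab3 a b c d e f) = tab3 a b c (b + e) (d - b) f.
Proof.
(* The [b] ones of the middle row match the first [b] zeros of the top row, so [z] is inert and the
   reflection acts on the zeros and ones that remain in the top row. *)
move=> bd; set z := nseq a 2 ++ nseq b 1 ++ nseq c 2 ++ nseq b 0.
have zc : ncls 0 z = 0 by rewrite /z !(ncls_cat, nopn_cat, ncls_nseq, nopn_nseq) /=; lia.
have zo : nopn 0 z = 0 by rewrite /z !(ncls_cat, nopn_cat, ncls_nseq, nopn_nseq) /=; lia.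
have E d' e' : tab3 a b c (b + d') e' f = insert_at 0 z (insert_at (d' + e') (nseq f 2)
    (nseq d' 0 ++ nseq e' 1)).
  rewrite /insert_at take0 drop0 take_oversize ?drop_oversize ?size_cat ?size_nseq //.
  by rewrite cats0 /z /tab3 nseqD -!catA.
rewrite -{1}(subnKC bd) E word_s_insert // word_s_insert ?ncls_nseq ?nopn_nseq //.
by rewrite word_s_nseq E addnC.
Qed.

Lemma word_s1_tab3 a b c d e f : is_tab3 a b c d e ->
  let b' := a + (c - e) + minn (b - a) f in
  let e' := minn c e + (f - (b - a)) in
  word_s 1 (tab3 a b c d e f) = tab3 a b' (b + c - b') d e' (e + f - e').
Proof.
move=> /and3P[ab bd bcde]; cbv zeta.
(* Two blocks of matched pairs: the [2]s of the bottom row with the first [a] ones of the middle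
   row, and the last [g] twos of the middle row with the first [g] ones of the top row. *)
set g := minn c e.
set z := nseq a 2 ++ nseq a 1; set z' := nseq g 2 ++ nseq d 0 ++ nseq g 1.
have zc : ncls 1 z = 0 by rewrite /z !(ncls_cat, nopn_cat, ncls_nseq, nopn_nseq) /=; lia.
have zo : nopn 1 z = 0 by rewrite /z !(ncls_cat, nopn_cat, ncls_nseq, nopn_nseq) /=; lia.
have zc' : ncls 1 z' = 0 by rewrite /z' !(ncls_cat, nopn_cat, ncls_nseq, nopn_nseq) /=; lia.
have zo' : nopn 1 z' = 0 by rewrite /z' !(ncls_cat, nopn_cat, ncls_nseq, nopn_nseq) /=; lia.
(* [m] counts the unmatched letters of the middle row; it is therefore the position of the block
   [z'] within the unmatched word. *)
pose m := (b - a) + (c - e).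
have E p q : m <= p + q ->
    insert_at 0 z (insert_at m z' (nseq p 1 ++ nseq q 2)) =
    tab3 a (a + minn p m) (m - minn p m + g) d (g + (p - m)) (q - (m - p)).
  move=> le; rewrite /insert_at take0 drop0 take_cat drop_cat size_nseq.
  have [mp|pm] := ltnP m p.
    rewrite take_nseq ?drop_nseq; last by lia.
    have -> : m - p = 0 by lia.
    by rewrite subnn subn0 add0n /tab3 !nseqD -!catA.
  rewrite take_nseq ?drop_nseq; last by lia.
  have -> : p - m = 0 by lia.
  by rewrite addn0 /tab3 !nseqD -!catA.
have -> : tab3 a b c d e f =
    insert_at 0 z (insert_at m z' (nseq ((b - a) + (e - c)) 1 ++ nseq ((c - e) + f) 2)).
  by rewrite E; [congr tab3|]; lia.
rewrite word_s_insert // word_s_insert // word_s_nseq E; last by lia.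
by congr tab3; lia.
Qed.

Definition braid01 w := word_s 0 (word_s 1 (word_s 0 w)) = word_s 1 (word_s 0 (word_s 1 w)).

(* The coordinates p = b - a and r = d - b turn the reflection of index 0 into the
   exchange of r and e. *)
Definition tab3_gap a p c r e f := tab3 a (a + p) c (a + p + r) e f.

Lemma word_s0_tab3_gap a p c r e f : word_s 0 (tab3_gap a p c r e f) = tab3_gap a p c e r f.
Proof. by rewrite /tab3_gap word_s0_tab3; [congr tab3|]; lia. Qed.

Lemma word_s1_tab3_gap a p c r e f : c <= r + e ->
  word_s 1 (tab3_gap a p c r e f) =
  if c <= e then
    if p <= f then tab3_gap a p c r (c + (f - p)) (p + (e - c))
    else tab3_gap a f (c + (p - f)) (r + (p - f)) c (f + (e - c))
  else
    if p <= f then tab3_gap a (p + (c - e)) e (r - (c - e)) (e + (f - p)) p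
    else tab3_gap a (f + (c - e)) (e + (p - f)) (r - (c - e) + (p - f)) e f.
Proof.
move=> h; rewrite /tab3_gap word_s1_tab3; last by apply/and3P; split; lia.
rewrite addKn; case: (leqP c e) => h1; case: (leqP p f) => h2; congr tab3; lia.
Qed.

(** The comparisons of [c] with [e], [p] with [f] and [c] with [r] determine every branch taken on
    both sides; in each of the eight regimes the two sides agree as linear expressions. *)
Lemma braid01_tab3_gap a p c r e f : c <= r + e -> braid01 (tab3_gap a p c r e f).
Proof.
move=> h; rewrite /braid01 word_s0_tab3_gap (word_s1_tab3_gap _ _ _ h).
rewrite word_s1_tab3_gap; last by rewrite addnC.
case: (leqP c e) => h1; case: (leqP p f) => h2; case: (leqP c r) => h3;
  rewrite !word_s0_tab3_gap word_s1_tab3_gap; do ?[by lia].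
all: have T1 x y : x <= y -> (x <= y) = true by [].
all: have T2 x y : y < x -> (x <= y) = false by move=> yx; rewrite leqNgt yx.
all: do ?[rewrite T1; last by lia | rewrite T2; last by lia].
all: by rewrite /tab3_gap; congr tab3; lia.
Qed.

Lemma braid01_tab3 a b c d e f : is_tab3 a b c d e -> braid01 (tab3 a b c d e f).
Proof.
case/and3P=> ab bd h; have := @braid01_tab3_gap a (b - a) c (d - b) e f.
by rewrite /tab3_gap !subnKC //; apply; lia.
Qed.

Lemma crystal_iso_s m i w : crystal_iso m -> i < 2 -> m (word_s i w) = word_s i (m w).
Proof.
case=> im sm cm om fm em hi; rewrite /word_s cm // om //; case: ifP => _.
  by elim: (_ - _) => //= k <-; rewrite fm.
by elim: (_ - _) => //= k <-; rewrite em.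
Qed.

Lemma braid01_plactic w w' : plactic w w' -> braid01 w' -> braid01 w.
Proof.
by case=> m im <- h; apply: (iso_inj im); rewrite !(crystal_iso_s _ im).
Qed.

Lemma word_s_neutral_catr i w s : all (ltn i.+1) s -> word_s i (w ++ s) = word_s i w ++ s.
Proof.
move=> hs; have [c0 o0] : ncls i s = 0 /\ nopn i s = 0.
  elim: s hs => //= x s IH /andP[hx /IH[-> ->]].
  by rewrite (gtn_eqF hx) (gtn_eqF (ltnW hx)).
have E u : size u = size w -> u ++ s = insert_at (size w) s u.
  by move=> su; rewrite /insert_at take_oversize ?drop_oversize ?cats0 ?su.
by rewrite E // word_s_insert // -E // size_word_s.
Qed.

Lemma braid01_word w : braid01 w.
Proof.
have [a [b [c [d [e [f [s [ht hs hw]]]]]]]] := plactic_tab3 w.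
have hs0 : all (ltn 1) s by apply: sub_all hs => x; apply: ltnW.
apply: braid01_plactic hw _; have := braid01_tab3 f ht.
by move: (tab3 _ _ _ _ _ _) => t; rewrite /braid01 !word_s_neutral_catr // => ->.
Qed.

(** Bracketing sees only where the two active letters stand, so relabelling commutes with the
    reflection as long as it keeps those letters apart from all others. *)
Lemma word_s_map i j g w : (forall x, (g x == j) = (x == i)) ->
    (forall x, (g x == j.+1) = (x == i.+1)) ->
  word_s j (map g w) = map g (word_s i w).
Proof.
move=> ej ej1; have /eqP gi : g i == j by rewrite ej.
have /eqP gi1 : g i.+1 == j.+1 by rewrite ej1.
have ec u : ncls j (map g u) = ncls i u by elim: u => //= x u ->; rewrite ej ej1.
have eo u : nopn j (map g u) = nopn i u by elim: u => //= x u ->; rewrite ej1 ec.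
have ef u : word_f j (map g u) = map g (word_f i u).
  elim: u => //= x u ->; rewrite ej ej1 ec; case: ifP => //= _.
  by case: ifP; rewrite ?gi1.
have ee u : word_e j (map g u) = map g (word_e i u).
  by elim: u => //= x u ->; rewrite ej1 ec; case: ifP => //= _; rewrite gi.
rewrite /word_s ec eo; case: ifP => _.
  by elim: (_ - _) => //= k ->.
by elim: (_ - _) => //= k ->.
Qed.

Lemma word_s_braid i w :
  word_s i (word_s i.+1 (word_s i w)) = word_s i.+1 (word_s i (word_s i.+1 w)).
Proof.
(* A relabelling that sends [i], [i + 1], [i + 2] to 0, 1, 2 and makes room by raising the letters
   below [i] by 3. *)
pose g k := if k < i then k + 3 else if k < i + 3 then k - i else k.
have ig : injective g by move=> x y; rewrite /g; do 4?[case: ltnP => ?]; lia.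
have E k : k < 3 -> forall x, (g x == k) = (x == i + k).
  by move=> k3 x; rewrite /g; do 2?[case: ltnP => ?]; lia.
have s0 u : word_s 0 (map g u) = map g (word_s i u).
  by apply: word_s_map => x; rewrite E ?addn0 ?addn1.
have s1 u : word_s 1 (map g u) = map g (word_s i.+1 u).
  by apply: word_s_map => x; rewrite E ?addn1 ?addn2.
apply: (inj_map ig); rewrite -!(s0, s1); exact: braid01_word.
Qed.

Lemma map_word_s (S : Type) (h : nat -> S) i w : h i = h i.+1 ->
  map h (word_s i w) = map h w.
Proof.
move=> hi; have ef u : map h (word_f i u) = map h u.
  elim: u => //= x u IH; case: ifP => /= _; first by rewrite IH.
  by case: eqP => // ->; rewrite hi.
have ee u : map h (word_e i u) = map h u.
  elim: u => //= x u IH; case: ifP => /= [/andP[/eqP-> _]|_]; last by rewrite IH.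
  by rewrite hi.
by rewrite /word_s; case: ifP => _; elim: (_ - _) => //= k <-; rewrite ?ef ?ee.
Qed.

Lemma word_s_comm i j w : i.+1 < j ->
  word_s i (word_s j w) = word_s j (word_s i w).
Proof.
(* A letter is determined by its images under [h i], [h j] and [r]. Under [h i] the reflection of
   index [j] is invisible, under [h j] that of index [i], and under [r] both are. *)
move=> ij; pose h k x := if x == k then 0 else if x == k.+1 then 1 else 2.
pose r x := if x \in [:: i; i.+1; j; j.+1] then 0 else x.+1.
have hs k u : word_s 0 (map (h k) u) = map (h k) (word_s k u).
  by apply: word_s_map => x; rewrite /h; case: (x =P k) => ?;
    case: (x =P k.+1) => ?; lia.
have hn k l u : (k.+1 < l) || (l.+1 < k) -> map (h k) (word_s l u) = map (h k) u.
  by move=> kl; apply: map_word_s; rewrite /h !ifF //; lia.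
have ei : map (h i) (word_s i (word_s j w)) = map (h i) (word_s j (word_s i w)).
  by rewrite -[LHS]hs !(hn i j) ?ij // hs.
have ej : map (h j) (word_s i (word_s j w)) = map (h j) (word_s j (word_s i w)).
  by rewrite -[RHS]hs !(hn j i) ?ij ?orbT // hs.
have er : map r (word_s i (word_s j w)) = map r (word_s j (word_s i w)).
  by rewrite !map_word_s // /r !inE ?eqxx ?orbT.
apply: (@eq_from_nth _ 0) => [|k]; rewrite !size_word_s // => kw.
have N (g : nat -> nat) u v : map g u = map g v -> size u = size w -> size v = size w ->
    g (nth 0 u k) = g (nth 0 v k).
  by move=> e su sv; rewrite -!(nth_map _ 0) ?su ?sv // e.
move: (N _ _ _ ei) (N _ _ _ ej) (N _ _ _ er); rewrite !size_word_s.
move: (nth 0 _ k) (nth 0 _ k) => a b /(_ erefl erefl) + /(_ erefl erefl) + /(_ erefl erefl).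
rewrite /h /r !inE; do 8?[case: eqP => ? /=]; lia.
Qed.

(** * Contents and the order of a Coxeter element *)

Section Counting.

Variable i : nat.
Implicit Type w : seq nat.

Lemma ncls_nopn_count w :
  ncls i w + count_mem i.+1 w = nopn i w + count_mem i w.
Proof.
by elim: w => //= x w; case: (x =P i) => ?; case: (x =P i.+1) => ? /=; lia.
Qed.

Lemma sumn_word_f w : 0 < ncls i w -> sumn (word_f i w) = (sumn w).+1.
Proof.
elim: w => //= x w IH; case: (x =P i.+1) => /= [->|xi].
  by case: (ltnP 1 (ncls i w)) => /= h; [rewrite IH; lia | lia].
case: (posnP (ncls i w)) => [->|h] /=; last by rewrite IH // addnS.
by case: (x =P i) => //= ->; rewrite addSn.
Qed.

Lemma sumn_word_e w : 0 < nopn i w -> (sumn (word_e i w)).+1 = sumn w.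
Proof.
elim: w => //= x w IH; case: ifP => [/andP[/eqP-> _]|_] /=; first by rewrite addSn.
by rewrite add0n -addnS => /IH->.
Qed.

Lemma iter_word_f k w : k <= ncls i w ->
  [/\ ncls i (iter k (word_f i) w) = ncls i w - k,
      nopn i (iter k (word_f i) w) = nopn i w + k
    & sumn (iter k (word_f i) w) = sumn w + k].
Proof.
elim: k => [|k IH] h; first by rewrite subn0 !addn0.
have [c0 o0 s0] := IH (ltnW h).
have pos : 0 < ncls i (iter k (word_f i) w) by rewrite c0; lia.
by rewrite /= sumn_word_f // !(word_f_ncls_nopn pos).1 !(word_f_ncls_nopn pos).2; split; lia.
Qed.

Lemma iter_word_e k w : k <= nopn i w ->
  [/\ ncls i (iter k (word_e i) w) = ncls i w + k,
      nopn i (iter k (word_e i) w) = nopn i w - k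
    & sumn (iter k (word_e i) w) + k = sumn w].
Proof.
elim: k => [|k IH] h; first by rewrite subn0 !addn0.
have [c0 o0 s0] := IH (ltnW h).
have pos : 0 < nopn i (iter k (word_e i) w) by rewrite o0; lia.
have := sumn_word_e pos.
by rewrite /= !(word_e_ncls_nopn pos).1 !(word_e_ncls_nopn pos).2 => ?; split; lia.
Qed.

Lemma word_s_ncls_nopn w :
  [/\ ncls i (word_s i w) = nopn i w, nopn i (word_s i w) = ncls i w
    & sumn (word_s i w) + nopn i w = sumn w + ncls i w].
Proof.
rewrite /word_s; case: leqP => h.
  by have [-> -> ->] := iter_word_f (leq_subr (nopn i w) (ncls i w)); split; lia.
by have [-> -> <-] := iter_word_e (leq_subr (ncls i w) (nopn i w)); split; lia.
Qed.

Lemma count_word_s_neq w k : k != i -> k != i.+1 -> count_mem k (word_s i w) = count_mem k w.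
Proof.
move=> /negbTE ki /negbTE ki1; have E u : count_mem k u = count id (map (pred1 k) u).
  by rewrite count_map.
by rewrite !E map_word_s //= -!(eq_sym k) ki ki1.
Qed.

(** The reflection exchanges the two unmatched counts, hence negates the difference of the
    multiplicities of [i] and [i + 1], and it keeps their sum. *)
Lemma count_word_s w :
  count_mem i (word_s i w) = count_mem i.+1 w /\
  count_mem i.+1 (word_s i w) = count_mem i w.
Proof.
have := ncls_nopn_count w; have := ncls_nopn_count (word_s i w).
have [-> -> _] := word_s_ncls_nopn w.
have E u : count_mem i u + count_mem i.+1 u = count id (map (predU (pred1 i) (pred1 i.+1)) u).
  rewrite count_map; elim: u => //= x u <-.
  by case: (x =P i) => ?; case: (x =P i.+1) => ? /=; lia.
have := E (word_s i w); rewrite map_word_s -?E /= ?eqxx ?orbT //; lia.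
Qed.

Lemma sumn_word_s w : sumn (word_s i w) + count_mem i.+1 w = sumn w + count_mem i w.
Proof.
by have := ncls_nopn_count w; have [_ _] := word_s_ncls_nopn w; lia.
Qed.

End Counting.

(** The indices run from [j + k - 1] down to [j], carrying the multiplicity of [j + k] down one
    letter at a time. The reflection of index [l] changes the sum of the letters by the multiplicity
    of [l] minus the carried one. *)
Lemma foldr_word_s w j k :
  let u := foldr word_s w (iota j k) in
  [/\ count_mem j u = count_mem (j + k) w,
      forall l, l < j -> count_mem l u = count_mem l w
    & sumn u + k * count_mem (j + k) w = sumn w + \sum_(j <= l < j + k) count_mem l w].
Proof.
elim: k j => [|k IH] j; first by split; rewrite ?addn0 ?mul0n ?big_geq ?addn0.
have [h1 h2 h3] := IH j.+1; rewrite -!addSnnS [foldr _ _ _]/=.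
split.
- by rewrite (count_word_s _ _).1 h1.
- by move=> l lj; rewrite count_word_s_neq ?h2 //; lia.
rewrite big_ltn; last by lia.
by have := sumn_word_s j (foldr word_s w (iota j.+1 k)); rewrite h1 h2 // mulSn; lia.
Qed.

Lemma sumn_coxeter_word m w : all (gtn m.+1) w ->
  sumn (foldr word_s w (iota 0 m)) + m.+1 * count_mem m w = sumn w + size w.
Proof.
move=> hw; have [_ _] := foldr_word_s w 0 m; rewrite add0n.
suff -> : size w = \sum_(0 <= l < m) count_mem l w + count_mem m w by rewrite mulSn; lia.
rewrite -big_nat_recr //= big_mkord.
elim: w hw => [_|x w IH] /=; first by rewrite big1.
case/andP=> xm /IH->; rewrite big_split -add1n; congr (_ + _).
rewrite (bigD1 (Ordinal xm)) //= eqxx.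
by rewrite big1 // => l; rewrite -val_eqE /= eq_sym => /negbTE->.
Qed.

(** * The order of a Coxeter element, from the Coxeter relations of type A *)

Section CoxeterOrder.

Local Open Scope group_scope.
Variables (gT : finGroupType) (s : nat -> gT).

Let c m := \prod_(0 <= i < m) s i.

Let c0 : c 0 = 1. Proof. exact: big_geq. Qed.

Let cS m : c m.+1 = c m * s m. Proof. exact: big_nat_recr. Qed.

Definition coxeter_rel m : Prop :=
  [/\ forall i, i < m -> s i * s i = 1,
      forall i j, i.+1 < j -> j < m -> s i * s j = s j * s i
    & forall i, i.+1 < m -> s i * s i.+1 * s i = s i.+1 * s i * s i.+1].

Lemma coxeter_relW m : coxeter_rel m.+1 -> coxeter_rel m.
Proof.
by case=> h1 h2 h3; split=> [i hi|i j ij hj|i hi]; [apply: h1|apply: h2|apply: h3]; lia.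
Qed.

Lemma coxeter_comm n m j : coxeter_rel n -> m < j -> j < n -> c m * s j = s j * c m.
Proof.
case=> _ h2 _; elim: m => [|m IH] mj jn; first by rewrite c0 mulg1 mul1g.
by rewrite cS -mulgA h2 // !mulgA IH //; lia.
Qed.

Lemma coxeter_conj m i : coxeter_rel m -> i.+1 < m -> s i.+1 * c m = c m * s i.
Proof.
elim: m => // m IH rel im; have [h1 h2 h3] := rel.
rewrite cS.
have [lt|ge] := ltnP i.+1 m.
  by rewrite mulgA (IH (coxeter_relW rel)) // -!mulgA h2.
have -> : m = i.+1 by lia.
rewrite cS !mulgA -(coxeter_comm rel) //.
by rewrite -!mulgA; congr (_ * _); rewrite !mulgA h3.
Qed.

Lemma coxeter_inv m : coxeter_rel m ->
  c m * \prod_(0 <= k < m) s (m - k.+1)%N = 1.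
Proof.
elim: m => [|m IH] rel; first by rewrite c0 big_geq // mulg1.
have [h1 _ _] := rel; rewrite big_nat_recl // cS.
rewrite subn1 /= -!mulgA (mulgA (s m)) h1 // mul1g -[RHS](IH (coxeter_relW rel)).
by congr (_ * _); apply: eq_bigr => k _; rewrite subSS.
Qed.

(** Moving one factor [c m.+1] to the left across the product lowers each of its indices by one, by
    [coxeter_conj]; the last generator of [c m.+1] then takes the vacant first place. *)
Lemma coxeter_pow m j : coxeter_rel m.+1 -> j <= m.+1 ->
  c m.+1 ^+ j = c m ^+ j * \prod_(0 <= k < j) s (m - k)%N.
Proof.
move=> rel; elim: j => [|j IH] jm; first by rewrite !expg0 big_geq // mulg1.
rewrite expgSr IH; last by lia.
have E : (\prod_(0 <= k < j) s (m - k)%N) * c m.+1 =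
         c m.+1 * \prod_(0 <= k < j) s (m - k.+1)%N.
  elim: j jm {IH} => [|j IH] jm; first by rewrite !big_geq // mulg1 mul1g.
  rewrite !big_nat_recr //= -mulgA (_ : m - j = (m - j.+1).+1)%N; last by lia.
  by rewrite coxeter_conj //; [rewrite !mulgA IH //|]; lia.
rewrite -mulgA E cS !mulgA -expgSr -mulgA.
by congr (_ * _); rewrite [RHS]big_nat_recl // subn0.
Qed.

(** In [coxeter_pow] with the largest exponent, the power of the shorter Coxeter element is trivial
    by induction, and the descending product left over is the inverse of the longer one. *)
Lemma coxeter_order m : coxeter_rel m -> c m ^+ m.+1 = 1.
Proof.
elim: m => [|m IH] rel; first by rewrite c0 expg1n.
rewrite expgS coxeter_pow // (IH (coxeter_relW rel)) mul1g -[RHS](coxeter_inv rel).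
by congr (_ * _); apply: eq_bigr => k _; rewrite subSS.
Qed.

End CoxeterOrder.

(** * From words to tableaux *)

Section TableauWord.

Variables (n : nat) (lam : intpart).
Implicit Types (T : {ffun cell lam -> 'I_n}) (i : 'I_n.-1).

Definition word T : seq nat := [seq val (T x) | x <- reading lam].

Lemma word_inj : injective word.
Proof.
move=> T T' /eq_in_map E; apply/ffunP => x; apply: val_inj.
by apply: E; apply: mem_reading.
Qed.

Let opn i T := [pred x | T x == letter_hi i].
Let cls i T := [pred x | T x == letter_lo i].

(** Compares the left-to-right stack with the counts computed from the right; the state [st] plays
    the left factor in the rule for concatenated words. *)
Lemma size_foldl_paren i T st (s : seq (cell lam)) :
  let st' := foldl (paren_step (opn i T) (cls i T)) st s in
  let w := [seq val (T x) | x <- s] in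
  size st'.1 = size st.1 + (ncls i w - size st.2) /\
  size st'.2 = (size st.2 - ncls i w) + nopn i w.
Proof.
elim: s st => [|x s IH] st /=; first by lia.
have [-> ->] := IH (paren_step (opn i T) (cls i T) st x).
rewrite /paren_step /= letter_hiP letter_loP.
case: (val (T x) =P i.+1) => h /=; first by lia.
by case: (val (T x) =P i :> nat) => h' /=; [case: st.2 => /= [|? ?]|]; lia.
Qed.

Lemma size_unmatched_cells i T :
  size (unmatched_cells i T).1 = ncls i (word T) /\
  size (unmatched_cells i T).2 = nopn i (word T).
Proof. by have := size_foldl_paren i T ([::], [::]) (reading lam); rewrite /= !subn0 sub0n. Qed.

Lemma word_set_entry T x k l r : reading lam = l ++ x :: r ->
  word (set_entry T x k) =
  [seq val (T y) | y <- l] ++ val k :: [seq val (T y) | y <- r].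
Proof.
move=> E; have := reading_uniq lam; rewrite /word E cat_uniq /=.
case/and3P=> _ /norP[xl _] /andP[xr _]; rewrite map_cat /= set_entry_self.
congr (_ ++ _ :: _); apply/eq_in_map => y yl; rewrite set_entry_ne //.
  by apply: contraNneq xl => <-.
by apply: contraNneq xr => <-.
Qed.

Lemma word_filling_f i T : word (filling_f i T) = word_f i (word T).
Proof.
have [c0 o0] := size_unmatched_cells i T; rewrite /filling_f.
case E: (unmatched_cells i T) c0 => [[|x c] o] /= c0; first by rewrite word_f_id.
have [l [r [Er /andP[_ /eqP Tx] El Hr]]] := unmatched_clsP E.
rewrite (word_set_entry _ _ Er) /word Er map_cat /= Tx word_f_cat /=.
(* The part before [x] leaves no pending opening and the part after it no unmatched closing, so
   [word_f] changes exactly the letter at [x]. *)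
have [_] := size_foldl_paren i T ([::], [::]) l; rewrite -[foldl _ _ _]/(unmatched _ _ l).
rewrite El /= sub0n add0n => ol; have [+ _] := size_foldl_paren i T ([::], [::]) r.
by rewrite Hr /= subn0 add0n => cr; rewrite -ol -cr ltn_eqF // eqxx.
Qed.

Lemma word_filling_e i T : word (filling_e i T) = word_e i (word T).
Proof.
have [c0 o0] := size_unmatched_cells i T.
case E: (unmatched_cells i T) o0 => [c o]; case/lastP: o E => [|o x] E /= o0.
  by rewrite /filling_e E word_e_id.
have [Tx -> _] := unmatched_e E.
have [l [r [Er _ El Hr]]] := unmatched_opnP E.
rewrite (word_set_entry _ _ Er) /word Er map_cat /= Tx word_e_cat /=.
have [_] := size_foldl_paren i T ([::], [::]) l; rewrite -[foldl _ _ _]/(unmatched _ _ l).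
rewrite El /= sub0n add0n => ol; have [+ _] := size_foldl_paren i T ([::], [::]) r.
by rewrite Hr /= subn0 add0n => cr; rewrite -cr -ol eqxx /=.
Qed.

Lemma word_crystal_s i (T : sst n lam) : word (crystal_s i T) = word_s i (word T).
Proof.
have := unmatched_content i T; have [-> ->] := size_unmatched_cells i T => h.
have F k (X : sst n lam) : word (iter k (crystal_f i) X) = iter k (word_f i) (word X).
  by elim: k => //= k <-; rewrite word_filling_f.
have G k (X : sst n lam) : word (iter k (crystal_e i) X) = iter k (word_e i) (word X).
  by elim: k => //= k <-; rewrite word_filling_e.
by rewrite /crystal_s /word_s; case: leqP => h1; case: leqP => h2; rewrite ?F ?G;
  try lia; congr (iter _ _ _); lia.
Qed.

Lemma word_sst_inj (T T' : sst n lam) : word T = word T' -> T = T'.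
Proof. by move/word_inj/val_inj. Qed.

(** Extended by the identity to all natural indices, to serve as a sequence of generators for
    [coxeter_rel]. *)
Definition crystal_perm (k : nat) : {perm sst n lam} :=
  if insub k is Some i then perm (inv_inj (@crystal_sK n lam i)) else 1%g.

Lemma word_crystal_perm k (T : sst n lam) : k < n.-1 ->
  word (crystal_perm k T) = word_s k (word T).
Proof. by move=> kn; rewrite /crystal_perm insubT permE word_crystal_s. Qed.

Lemma crystal_permK k (T : sst n lam) : crystal_perm k (crystal_perm k T) = T.
Proof.
rewrite /crystal_perm; case: insubP => [i _ _|_]; last by rewrite !perm1.
by rewrite !permE crystal_sK.
Qed.

Lemma crystal_perm_rel : coxeter_rel crystal_perm n.-1.
Proof.
split=> [i _|i j ij jn|i ni]; apply/permP => T; rewrite !permM.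
- by rewrite crystal_permK perm1.
- have ni : i < n.-1 by lia.
  by apply: word_sst_inj; rewrite !word_crystal_perm //; rewrite (word_s_comm _ ij).
have ni' := ltnW ni.
by apply: word_sst_inj; rewrite !word_crystal_perm //; rewrite word_s_braid.
Qed.

Lemma coxeter_permE (T : sst n lam) :
  coxeter_perm n lam T = foldr (fun k : nat => crystal_perm k) T (iota 0 n.-1).
Proof.
rewrite permE /coxeter_map -val_enum_ord.
elim: (enum _) => //= i s ->; rewrite /crystal_perm.
by case: insubP => [j _ /val_inj->|]; rewrite ?permE // ltn_ord.
Qed.

Lemma coxeter_perm_exp : 0 < n -> (coxeter_perm n lam ^+ n = 1)%g.
Proof.
(* Products of permutations apply their left factor first, so the ascending product is the inverse
   of [coxeter_perm]. *)
move=> n0; have e : (coxeter_perm n lam * \prod_(0 <= k < n.-1) crystal_perm k = 1)%g.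
  apply/permP => T; rewrite permM perm1 coxeter_permE /index_iota subn0.
  elim: (iota _ _) => [|k s IH] /=; first by rewrite big_nil perm1.
  by rewrite big_cons permM crystal_permK.
have := coxeter_order crystal_perm_rel; rewrite prednK // => e'.
by rewrite -(invgK (coxeter_perm _ _)) (mulg1_eq e) expgVn e' invg1.
Qed.

Lemma size_word T : size (word T) = sumn lam.
Proof.
rewrite size_map -[size _]count_predT count_reading cardsE card_tagged.
have -> : sumn lam = \sum_(r < size lam) nth 0 lam r.
  by rewrite sumnE (big_nth 0) big_mkord.
rewrite sumnE big_map big_enum.
by apply: eq_bigr => r _; rewrite card_ord.
Qed.

Lemma sumn_word T : sumn (word T) = \sum_(x : cell lam) T x.
Proof.
rewrite sumnE big_map (perm_big (enum (cell lam))) ?big_enum //.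
by apply/permPl; apply: perm_sort.
Qed.

Lemma sumn_word_coxeter (T : sst n lam) : 0 < n ->
  sumn (word (coxeter_perm n lam T)) = sumn (word T) + sumn lam %[mod n].
Proof.
move=> n0; have -> : word (coxeter_perm n lam T) = foldr word_s (word T) (iota 0 n.-1).
  rewrite coxeter_permE; have : all (gtn n.-1) (iota 0 n.-1).
    by apply/allP => k; rewrite mem_iota.
  by elim: (iota _ _) => //= k s IH /andP[kn /IH<-]; rewrite word_crystal_perm.
have := @sumn_coxeter_word n.-1 (word T); rewrite prednK // size_word => <-.
  by rewrite addnC mulnC modnMDl.
by apply/allP => _ /mapP[x _ ->] /=.
Qed.

End TableauWord.

(** * Free orbits and values of the sieving polynomial *)

Lemma sumn_word_coxeterX n lam (T : sst n lam) j : 0 < n ->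
  sumn (word ((coxeter_perm n lam ^+ j)%g T)) = sumn (word T) + j * sumn lam %[mod n].
Proof.
move=> n0; elim: j => [|j IH]; first by rewrite expg0 perm1 addn0.
rewrite expgSr permM sumn_word_coxeter // -modnDml IH modnDml mulSn.
by rewrite -addnA (addnC (j * _)).
Qed.

Lemma coxeterX_fix n lam (T : sst n lam) j : 0 < n -> coprime n (sumn lam) ->
  (coxeter_perm n lam ^+ j)%g T = T -> n %| j.
Proof.
move=> n0 cop fixT; have := sumn_word_coxeterX T j n0; rewrite fixT.
move/eqP; rewrite -{1}[sumn (word T)]addn0 eqn_modDl mod0n eq_sym -/(n %| _).
by rewrite Gauss_dvdl.
Qed.

(** Each cell receives its row index. Some tableau is needed to exclude that the group has order a
    proper divisor of [n]. *)
Lemma sst_inhabited n lam : size (parts lam) <= n -> inhabited (sst n lam).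
Proof.
move=> le; pose T : {ffun cell lam -> 'I_n} := [ffun x => widen_ord le (tag x)].
suff sT : semistandard T by constructor; exact: SST sT.
apply/semistandardP; split=> x y e h; rewrite !ffunE //.
by rewrite leq_eqVlt (_ : val _ == _) //; apply/eqP.
Qed.

Definition natC (k : nat) : algC := k%:R%R.

Fact natC_nmod_morphism : nmod_morphism natC.
Proof. by split=> // k l; rewrite /natC natrD. Qed.

Fact natC_monoid_morphism : monoid_morphism natC.
Proof. by split=> // k l; rewrite /natC natrM. Qed.

HB.instance Definition _ := GRing.isNmodMorphism.Build nat algC natC natC_nmod_morphism.
HB.instance Definition _ := GRing.isMonoidMorphism.Build nat algC natC natC_monoid_morphism.

(** Keeping the factor [w ^+ kappa lam] avoids negative powers; the monomial of [T] is regrouped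
    cell by cell into [w] to the sum of the entries. *)
Lemma horner_schur_sieving n lam (w : algC) :
  (((map_poly (fun k : nat => k%:R) (schur_sieving n lam)).[w] * w ^+ kappa lam) =
  \sum_(T : sst n lam) w ^+ sumn (word T))%R.
Proof.
have := congr1 (fun p => (map_poly natC p).[w])%R (schur_principalE n lam).
rewrite rmorphM /= hornerM map_polyXn hornerXn => <-.
rewrite /schur_principal /schur rmorph_sum horner_sum; apply: eq_bigr => T _.
rewrite rmorph_prod horner_prod sumn_word (partition_big T predT) //= expr_sum.
apply: eq_bigr => k _; rewrite rmorphXn /= map_polyXn horner_exp hornerXn -exprM.
rewrite (eq_bigr (fun=> k : nat)) => [|x /eqP->//].
by rewrite sum_nat_const mulnC /content cardsE.
Qed.

Unset Implicit Arguments.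

Theorem theorem3p3 (n : nat) (lam : intpart) (n_ge2 : 2 <= n)
    (len_lam : size lam < n) (coprime_n : gcdn n (sumn lam) = 1) :
  [/\ #|coxeter_group n lam| = n,
      forall T : sst n lam, #|orbit 'P (coxeter_group n lam) T| = n
    & exhibits_csp (coxeter_group n lam) 'P (schur_sieving n lam)].
Proof.
have n0 : 0 < n by lia.
have cop : coprime n (sumn lam) by rewrite /coprime coprime_n.
have fixP := fun T j => @coxeterX_fix n lam T j n0 cop.
set c := coxeter_perm n lam in fixP *.
have cn : (c ^+ n = 1)%g by apply: coxeter_perm_exp.
have free T g : g \in coxeter_group n lam -> g T = T -> g = 1%g.
  by case/cycleP=> j ->; move/fixP/dvdnP=> [k ->]; rewrite mulnC expgM cn expg1n.
have [T0] := sst_inhabited (ltnW len_lam).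
have oc : #|coxeter_group n lam| = n.
  apply/eqP; rewrite eqn_dvd -orderE order_dvdn cn eqxx /=.
  (* The power of [c] by its own order fixes [T0], so [n] divides that order. *)
  by apply: (fixP T0); rewrite expg_order perm1.
split=> // [T|].
  rewrite card_orbit (_ : 'C_(coxeter_group n lam)[T | 'P] = 1)%g ?indexg1 //.
  apply/trivgP/subsetP => g /setIP[gC /astab1P gT]; apply/set1P.
  exact: free gT.
split; first exact: cycle_cyclic.
(* For the identity [w] is 1 and the sum counts all tableaux; any other [g] has no fixed point, so
   the polynomial has to vanish at [w]. *)
move=> g w gC pw; have [g1|ng] := eqVneq g 1%g.
  move: pw; rewrite g1 order1 => /prim_expr_order; rewrite expr1 => w1.
  have := horner_schur_sieving n lam w; rewrite {w}w1 expr1n mulr1 => ->.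
  rewrite (eq_bigr (fun=> 1%R)) => [|T _]; last by rewrite expr1n.
  rewrite sumr_const; congr (_%:R)%R; apply: eq_card => T.
  by apply/afix1P; rewrite /= /aperm perm1.
have -> : ('Fix_'P[g])%g = set0.
  apply/setP => T; rewrite in_set0; apply/negP => /afix1P gT.
  by case/eqP: ng; apply: free gT.
rewrite cards0; have gn : #[g]%g %| n by have := order_dvdG gC; rewrite oc.
have wn : (w ^+ n = 1)%R by apply/eqP; rewrite -(prim_order_dvd pw).
have w0 : (w != 0)%R by apply/eqP => e; move/eqP: wn; rewrite e expr0n gtn_eqF // eq_sym oner_eq0.
have wl : (w ^+ sumn lam != 1)%R.
  (* Otherwise the order of [g] would divide both [n] and [sumn lam], and [g] would be trivial. *)
  rewrite -(prim_order_dvd pw); apply: contra ng => gl.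
  by rewrite -order_eq1 -dvdn1 -coprime_n dvdn_gcd gn.
have /eqP := horner_schur_sieving n lam w.
set S := (\sum_(T : _) _)%R.
have : (S = w ^+ sumn lam * S)%R.
  rewrite {1}/S (reindex_inj (@perm_inj _ c)) mulr_sumr; apply: eq_bigr => T _.
  rewrite -exprD -(expr_mod _ wn) sumn_word_coxeter // expr_mod //.
  by rewrite addnC.
(* Since [w ^+ sumn lam] is not 1, [S] vanishes, and the nonzero power of [w] can be cancelled. *)
move/eqP; rewrite -subr_eq0 -{1}[S]mul1r -mulrBl mulf_eq0 subr_eq0 eq_sym (negbTE wl).
by move=> /eqP->; rewrite mulf_eq0 expf_eq0 (negbTE w0) andbF orbF => /eqP->.
Qed.
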